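(* Let $\mathbf{f}:\mathbb{R}^2\to\mathbb{R}^2$ be locally Lipschitz and consider the ordinary differential equation $\frac{d\mathbf{x}}{dt}=\mathbf{f}(\mathbf{x})$ in the plane. Let $\Omega\subset\mathbb{R}^2$ be a minimal set of this equation. Then either $\Omega=\{\mathbf{y}\}$ for some $\mathbf{y}$ with $\mathbf{f}(\mathbf{y})=\mathbf{0}$ (i.e. $\Omega$ is the image of a stationary solution), or $\Omega$ is the image of a periodic solution of the equation.
   Context: A set $M\subset\mathbb{R}^2$ is called invariant (in the forward sense) for $\frac{d\mathbf{x}}{dt}=\mathbf{f}(\mathbf{x})$ if for every $\mathbf{y}\in M$ the solution $\mathbf{x}(\cdot)$ with $\mathbf{x}(0)=\mathbf{y}$ is defined on $[0,\infty)$ and satisfies $\mathbf{x}(t)\in M$ for all $t\ge 0$. A minimal set is a nonempty closed invariant set that is minimal with respect to inclusion, i.e. it contains no proper subset that is itself nonempty, closed and invariant. A periodic solution is a solution $\mathbf{x}(\cdot)$ for which there is $T>0$ with $\mathbf{x}(t+T)=\mathbf{x}(t)$ for all $t$. *)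

(* Defs.v *)
From HB Require Import structures.
From mathcomp Require Export all_boot all_order all_algebra.
From mathcomp Require Export all_classical all_reals all_analysis.
Export numFieldNormedType.Exports.
Export Order.TTheory GRing.Theory Num.Theory.

Set Implicit Arguments.
Unset Strict Implicit.
Unset Printing Implicit Defensive.

Local Open Scope classical_set_scope.
Local Open Scope ring_scope.

(* The plane is ['rV[R]_2]. Its norm is the sup norm, which is equivalent to the
   Euclidean one, so local Lipschitz continuity, differentiability of curves and
   closedness do not depend on this choice. *)

Definition locally_lipschitz (R : realType) (V : normedModType R) (f : V -> V) :=
  forall p : V, exists2 U : set V, nbhs p U & [lipschitz f z | z in U].

(* [x] solves dx/dt = f(x) on the interval [J]. The derivative at [t] is relative
   to [J], hence one-sided at an endpoint of [J] that belongs to [J]; the values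
   of [x] outside [J] are irrelevant. *)
Definition solution_on (R : realType) (V : normedModType R) (f : V -> V)
    (J : set R) (x : R -> V) :=
  forall t : R, J t ->
    (s - t)^-1 *: (x s - x t) @[s --> within J t^'] --> f (x t).

(* The existential stands for "the solution from [y] is defined on [0, +oo[ and
   stays in [M]": when [f] is locally Lipschitz, the solution is unique. *)
Definition forward_invariant (R : realType) (V : normedModType R) (f : V -> V)
    (M : set V) :=
  forall y : V, M y -> exists x : R -> V,
    [/\ solution_on f `[0, +oo[ x, x 0 = y & forall t : R, 0 <= t -> M (x t)].

Definition nonempty_closed_invariant (R : realType) (V : normedModType R) (f : V -> V)
    (M : set V) :=
  [/\ M !=set0, closed M & forward_invariant f M].

Definition minimal_set (R : realType) (V : normedModType R) (f : V -> V)
    (M : set V) :=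
  nonempty_closed_invariant f M /\
  forall N : set V, nonempty_closed_invariant f N -> N `<=` M -> N = M.

Definition periodic_solution (R : realType) (V : normedModType R) (f : V -> V)
    (x : R -> V) :=
  solution_on f setT x /\ exists2 T : R, 0 < T & periodic x T.

Lemma solution_on_setT (R : realType) (V : normedModType R) (f : V -> V)
    (x : R -> V) :
  solution_on f setT x <-> forall t : R, is_derive t 1 x (f (x t)).
Proof.
have E (t : R) : within setT t^' = t^'.
  by apply/seteqP; split=> A /=; rewrite /within /=; apply: filterS => s; [apply|].
have D (t : R) (l : V) :
    ((s - t)^-1 *: (x s - x t) @[s --> t^'] --> l) <->
    (h^-1 *: (x (h *: 1 + t) - x t) @[h --> 0^'] --> l).
  split=> H A /H; rewrite /nbhs /= /dnbhs /within /= => -[e /= e0 He];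
    exists e => //= s /= sb sN.
  - rewrite /= in He *; have := He (s + t).
    rewrite /ball /= opprD addrCA subrr addr0 [s *: 1]mulr1 addrK.
    apply; first by move: sb; rewrite /ball /= sub0r.
    by rewrite -subr_eq0 addrK.
  - have := He (s - t); rewrite /= [(s - t) *: 1]mulr1 subrK; apply.
      by move: sb; rewrite /ball /= sub0r opprB.
    by rewrite subr_eq0.
split=> [H t|H t _].
- have := H t I; rewrite E => /D Ht.
  apply: DeriveDef; first by apply/cvg_ex; exists (f (x t)).
  exact: cvg_lim Ht.
- rewrite E; apply/D; case: (H t) => + <-; exact.
Qed.

(* Main.v *)
Require Import Defs.
From mathcomp Require Import ring lra.

Set Implicit Arguments.
Unset Strict Implicit.
Unset Printing Implicit Defensive.

Local Open Scope classical_set_scope.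
Local Open Scope ring_scope.

(* A non-stationary orbit of a minimal set is recurrent (by minimality the closure
   of each of its tails is the whole set), and a recurrent orbit x of a planar
   equation cannot be injective, hence is periodic.  To see the latter without the
   Jordan curve theorem, let p = x(1), let x(t1) be a later point of the orbit on the
   normal line to f(p) at p, and x(t3), x(t2) points of the orbit just after x(t1)
   and (by recurrence) just before p.  The closed curves
     C = x[1, t1] + chord x(t1) -> p   and   D = x[t3, t2] + chord x(t2) -> x(t3)
   have algebraic intersection number zero.  But the two arcs of orbit are disjoint,
   and in each of the three other pairs all intersections have the same sign,
   while the two chords do cross: a contradiction.
   The intersection number is mollified: with a bump phi(z) = a(z_1) a(z_2)
   supported near 0 and A' = a, the function
     N(z) = \oint_C A(c_1 - z_1) a(c_2 - z_2) dc_2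
   is a smoothed winding number of C around z, and along a curve d(t) its derivative
   is \oint_C phi(c - d(t)) det(c', d'(t)), which has a constant sign on D. *)

(** * Real induction and forward solutions *)

(** The supremum of the [s] such that [P] holds on [[a, s]] has this property by the first
    hypothesis, and the second one forces it to be [b]. It serves below to follow solutions for as
    long as a local estimate applies. *)
Lemma real_induction (R : realType) (a b : R) (P : R -> Prop) :
  (forall t, a <= t <= b -> (forall s, a <= s < t -> P s) -> P t) ->
  (forall t, a <= t < b -> (forall s, a <= s <= t -> P s) ->
     exists2 d, 0 < d & forall s, t < s < t + d -> s <= b -> P s) ->
  forall t, a <= t <= b -> P t.
Proof.
move=> Hc Hr t /andP[at_ tb].
pose E := [set s | a <= s <= b /\ forall r, a <= r <= s -> P r].
have Pa : P a by apply: Hc => [|s /andP[/le_lt_trans h /h]]; rewrite ?lexx ?(le_trans at_ tb) ?ltxx.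
have Ea : E a.
  split; first by rewrite lexx (le_trans at_ tb).
  by move=> r /le_anti <-.
have supE : has_sup E by split; [exists a|exists b => s [/andP[]]].
have asE : a <= sup E by apply: ub_le_sup => //; case: supE.
have sEb : sup E <= b by apply: ge_sup => //; [exists a|move=> s [/andP[]]].
have EsE : E (sup E).
  split; first by rewrite asE.
  have lt s : a <= s < sup E -> P s.
    move=> /andP[as_ sE]; have [||e [_ He]] := @sup_adherent _ E (sup E - s) => //.
      by rewrite subr_gt0.
    by rewrite opprB addrC subrK => /ltW se; apply: He; rewrite as_.
  move=> r /andP[ar]; rewrite le_eqVlt => /orP[/eqP->|rE]; last by apply: lt; rewrite ar.
  by apply: Hc => //; rewrite asE.
have [_ H] := EsE.
have [bE|Eb] := leP b (sup E); first by apply: H; rewrite at_ (le_trans tb).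
have [||d d0 Hd] := Hr (sup E) => //; first by rewrite asE.
pose s := Num.min b (sup E + d / 2).
have Es : E s.
  split.
    by rewrite /s ge_min lexx le_min andbT (le_trans asE (ltW Eb))/=; lra.
  move=> r /andP[ar rs]; have [rE|Er] := leP r (sup E); first by apply: H; rewrite ar.
  move: rs; rewrite /s le_min => /andP[rb rE]; apply: Hd => //.
  by rewrite Er (le_lt_trans rE)// ltrD2l; lra.
have : s <= sup E by apply: ub_le_sup => //; case: supE.
by rewrite /s ge_min leNgt Eb /= leNgt ltrDl divr_gt0.
Qed.

Lemma is_derive_coord (R : realType) (m n : nat) (u : R -> 'M[R]_(m, n)) (l : 'M[R]_(m, n)) (t : R) i j :
  is_derive t 1 u l -> is_derive t 1 (fun s => u s i j) (l i j).
Proof.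
case=> du <-; have := du; move/derivable_mxP => /(_ i j) duij.
by split => //; rewrite derive_mx// mxE.
Qed.

Lemma is_derive_continuous (R : realType) (V : normedModType R) (u : R -> V) (l : V) (t : R) :
  is_derive t 1 u l -> {for t, continuous u}.
Proof. by case=> du _; apply: differentiable_continuous; apply/derivable1_diffP. Qed.

Lemma is_derive_affine (R : realType) (V : normedModType R) (u : R -> V) (l : V) (t c k : R) :
  is_derive (c + k * t) 1 u l -> is_derive t 1 (fun s => u (c + k * s)) (k *: l).
Proof.
move=> du; have cu : differentiable u (c + k * t) by apply/derivable1_diffP; case: du.
have dg : is_derive t 1 (fun s : R => c + k * s) k.
  have -> : (fun s : R => c + k * s) = cst c + (k *: id) by apply/funext.
  apply: is_derive_eq; by rewrite add0r [k *: 1]mulr1.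
have dgf : differentiable (fun s : R => c + k * s) t by apply/derivable1_diffP; case: dg.
split; first by apply/derivable1_diffP; apply: (@differentiable_comp _ _ _ _ (fun s : R => c + k * s) u).
rewrite deriveE; last exact: (@differentiable_comp _ _ _ _ (fun s : R => c + k * s) u).
rewrite (@diff_comp _ _ _ _ (fun s : R => c + k * s) u) //=.
have -> : 'd (fun s : R => c + k * s) t 1 = k *: 1 :> R.
  by rewrite -deriveE// [k *: 1]mulr1; case: dg.
by rewrite linearZ/= -deriveE//; case: du => _ ->.
Qed.

Section ode.
Context {R : realType} {V : normedModType R}.
Implicit Types (f : V -> V) (u v : R -> V).

(** The derivative is two-sided even at time 0, which avoids a separate treatment of that endpoint;
    [solution_on_forward] shows that this is no restriction. *)
Definition forward_solution f u := forall t : R, 0 <= t -> is_derive t 1 u (f (u t)).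

Lemma forward_solution_shift f u (s : R) : 0 <= s -> forward_solution f u ->
  forward_solution f (fun t => u (s + t)).
Proof.
move=> s0 H t t0; have := H (s + t) (addr_ge0 s0 t0).
rewrite -{1}(mul1r t) => /is_derive_affine; rewrite scale1r.
by under eq_fun do rewrite mul1r.
Qed.

Lemma forward_solution_cst f y : f y = 0 -> forward_solution f (cst y).
Proof. by move=> fy t _; rewrite fy; exact: is_derive_cst. Qed.

Lemma forward_solution_on f u : forward_solution f u -> solution_on f `[0, +oo[ u.
Proof.
move=> H t /=; rewrite in_itv/= andbT => t0.
have D : h^-1 *: (u (h *: 1 + t) - u t) @[h --> 0^'] --> f (u t).
  by have [du <-] := H _ t0.
move=> A /D; rewrite /nbhs /= /dnbhs /within /= => -[e /= e0 He].
exists e => //= s /= sb st s0.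
have := He (s - t); rewrite /= [(s - t) *: 1]mulr1 subrK; apply.
  by move: sb; rewrite /ball /= sub0r opprB.
by rewrite subr_eq0.
Qed.

Lemma solution_on_forward f x : solution_on f `[0, +oo[ x ->
  exists2 u, forward_solution f u & forall t, 0 <= t -> u t = x t.
Proof.
(* Before time 0 the solution is prolonged by its tangent line, so that the derivative at 0 exists
   from both sides. *)
move=> H; exists (fun t => if 0 <= t then x t else x 0 + t *: f (x 0)); last by move=> t ->.
set u := (fun t => _).
have u0 t : 0 <= t -> u t = x t by rewrite /u => ->.
move=> t t0; rewrite u0//.
suff D : h^-1 *: (u (h *: 1 + t) - u t) @[h --> 0^'] --> f (x t).
  by apply: DeriveDef; [apply/cvg_ex; exists (f (x t))|exact: cvg_lim D].
move=> A Af; have := H t; rewrite /= in_itv/= andbT => /(_ t0) /(_ _ Af).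
rewrite /nbhs /= /dnbhs /within /= => -[e /= e0 He].
move: t0; rewrite le_eqVlt => /orP[/eqP t0|t0].
  subst t; exists e => //= h /= hb h0; rewrite [h *: 1]mulr1 addr0.
  have [h_ge0|h_lt0] := leP 0 h.
    rewrite !u0//; have := He h; rewrite subr0; apply => //.
    by rewrite in_itv/= h_ge0.
  rewrite {1}/u leNgt h_lt0/= u0// addrC addKr scalerA mulVf// scale1r.
  exact: nbhs_singleton.
exists (Num.min e t) => //=; first by rewrite lt_min e0 t0.
move=> h; rewrite /ball/= sub0r normrN lt_min => /andP[he ht] h0.
have ht0 : 0 <= h + t by move: ht; rewrite ltr_norml => /andP[? _]; lra.
rewrite [h *: 1]mulr1 !u0//; last exact: ltW.
have := He (h + t); rewrite addrK; apply.
- by rewrite /ball/= opprD addrCA subrr addr0 normrN.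
- by rewrite -subr_eq0 addrK.
- by rewrite in_itv/= ht0.
Qed.

End ode.

(** * Continuous dependence on the initial condition *)

Section plane.
Context {R : realType}.
Implicit Types (z w : 'rV[R]_2) (e : R).

Lemma ler_norm_coord z i : `|z 0 i| <= `|z|.
Proof.
rewrite [leRHS]/Num.norm/= mx_normrE.
by rewrite (le_trans _ (le_bigmax _ _ (0 : 'I_1, i))).
Qed.

Lemma norm_ltP z e : 0 < e -> `|z 0 0| < e -> `|z 0 1| < e -> `|z| < e.
Proof.
move=> e0 z0 z1; rewrite [ltLHS]/Num.norm/= mx_normrE; apply/bigmax_ltP; split=> // -[i j] _ /=.
rewrite (ord1 i); case: j => -[|[|//]] /= h.
- by rewrite (_ : Ordinal h = 0)//; apply/val_inj.
- by rewrite (_ : Ordinal h = 1)//; apply/val_inj.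
Qed.

Lemma norm_leP z e : 0 <= e -> `|z 0 0| <= e -> `|z 0 1| <= e -> `|z| <= e.
Proof.
move=> e0 z0 z1; rewrite [leLHS]/Num.norm/= mx_normrE; apply/bigmax_leP; split=> // -[i j] _ /=.
rewrite (ord1 i); case: j => -[|[|//]] /= h.
- by rewrite (_ : Ordinal h = 0)//; apply/val_inj.
- by rewrite (_ : Ordinal h = 1)//; apply/val_inj.
Qed.

Lemma row2P z w : z 0 0 = w 0 0 -> z 0 1 = w 0 1 -> z = w.
Proof.
move=> z0 z1; apply/rowP => -[[|[|//]] /= h].
- by rewrite (_ : Ordinal h = 0)//; apply/val_inj.
- by rewrite (_ : Ordinal h = 1)//; apply/val_inj.
Qed.

End plane.

Lemma continuous_le_left (R : realType) (G : R -> R) (a t c : R) :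
  a < t -> {for t, continuous G} -> (forall s, a <= s < t -> G s <= c) -> G t <= c.
Proof.
move=> at_ cG H; rewrite leNgt; apply/negP => ct.
have /nbhs_ballP[e /= e0 He] : \forall s \near t, c < G s.
  exact: (cvgr_gt _ cG).
pose s := Num.max a (t - e / 2).
have st : s < t by rewrite /s gt_max at_/=; lra.
have te : t - e / 2 <= s by rewrite /s le_max lexx orbT.
have : c < G s by apply: He; rewrite /ball/= gtr0_norm ?subr_gt0//; lra.
by rewrite ltNge H// st /s le_max lexx.
Qed.

Lemma le0_is_derive_le (R : realType) (G dG : R -> R) (a b : R) : a <= b ->
  (forall t, a <= t <= b -> is_derive t 1 G (dG t)) ->
  (forall t, a <= t <= b -> dG t <= 0) -> G b <= G a.
Proof.
move=> ab D N.
have [||c cab E] := @MVT_segment R G dG a b ab.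
- by move=> t; rewrite in_itv/= => /andP[? ?]; apply: D; rewrite !ltW.
- apply: continuous_in_subspaceT => t; rewrite inE/= in_itv/=.
  by move=> /D/is_derive_continuous.
rewrite -subr_le0 E mulr_le0_ge0 ?subr_ge0//.
by apply: N; move: cab; rewrite in_itv.
Qed.

(** In [gronwall] the squared Euclidean distance grows at rate at most [4 * L], hence the distance
    at rate [2 * L]; the factor 2 covers the comparison of the Euclidean and sup norms. *)
Definition gronwall_const (R : realType) (L d : R) : R := 2 * expR (2 * L * d).

Lemma gronwall_const_gt0 (R : realType) (L d : R) : 0 < gronwall_const L d.
Proof. by rewrite mulr_gt0 ?expR_gt0. Qed.

(** The squared Euclidean distance times [expR (- (4 * L * t))] does not increase while both
    solutions stay in the ball where [f] is Lipschitz. Only [u] is assumed to stay there: the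
    estimate itself keeps [v] in the ball, whence the real induction. *)
Lemma gronwall (R : realType) (f : 'rV[R]_2 -> 'rV[R]_2) (p : 'rV[R]_2) (r L d : R)
    (u v : R -> 'rV[R]_2) (C := gronwall_const L d) :
  0 < r -> 0 <= L ->
  (forall z z', `|z - p| < r -> `|z' - p| < r -> `|f z - f z'| <= L * `|z - z'|) ->
  forward_solution f u -> forward_solution f v ->
  (forall t, 0 <= t <= d -> `|u t - p| <= r / 2) ->
  C * `|v 0 - u 0| < r / 2 ->
  forall t, 0 <= t <= d -> `|v t - u t| <= C * `|v 0 - u 0|.
Proof.
move=> r0 L0 Lf fu fv ur v0r.
pose w (t : R) := v t - u t.
pose g (t : R) := (w t 0 0) ^+ 2 + (w t 0 1) ^+ 2.
pose dg (t : R) := 2 * w t 0 0 * (f (v t) - f (u t)) 0 0 + 2 * w t 0 1 * (f (v t) - f (u t)) 0 1.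
pose G (t : R) := g t * expR (- (4 * L * t)).
pose dG (t : R) := (dg t - 4 * L * g t) * expR (- (4 * L * t)).
have dw (t : R) (i : 'I_2) : 0 <= t -> is_derive t 1 (fun s => w s 0 i) ((f (v t) - f (u t)) 0 i).
  move=> t0; apply: (@is_derive_coord _ _ _ w).
  by have := fv t t0; have := fu t t0 => ? ?; apply: is_deriveB.
have dgt (t : R) : 0 <= t -> is_derive t 1 g (dg t).
  move=> t0; have d0 := dw t 0 t0; have d1 := dw t 1 t0.
  apply: (is_derive_eq (is_deriveD (is_deriveX 2 d0) (is_deriveX 2 d1))); rewrite /dg /= !expr1 -![_ *: _]/(_ * _); ring.
have dGt (t : R) : 0 <= t -> is_derive t 1 G (dG t).
  move=> t0; have d0 := dgt t t0.
  have dl : is_derive t 1 (fun s : R => - (4 * L * s)) (- (4 * L)).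
    have -> : (fun s : R => - (4 * L * s)) = (- (4 * L)) *: id.
      by apply/funext => s /=; rewrite -mulNr.
    by apply: is_derive_eq; rewrite [_ *: 1]mulr1.
  have de := @is_derive1_comp _ expR (fun s => - (4 * L * s)) t _ _ (is_derive_expR _) dl.
  apply: (is_derive_eq (is_deriveM d0 de)).
  rewrite /dG -![_ *: _]/(_ * _) /=; ring.
have w2 (t : R) : `|w t| ^+ 2 <= g t.
  suff : `|w t| <= Num.sqrt (g t).
    by move=> h; rewrite -[leRHS]sqr_sqrtr ?addr_ge0 ?sqr_ge0// ler_sqr ?nnegrE ?sqrtr_ge0.
  by apply: norm_leP; rewrite ?sqrtr_ge0// -sqrtr_sqr ler_wsqrtr// /g ?lerDl ?lerDr sqr_ge0.
have wC (t : R) : 0 <= t <= d -> G t <= g 0 -> `|w t| <= C * `|w 0|.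
  move=> /andP[t0 td] Gt; rewrite -ler_sqr ?nnegrE ?mulr_ge0 ?expR_ge0//.
  rewrite (le_trans (w2 t))//.
  have -> : g t = G t * expR (4 * L * t) by rewrite /G -mulrA -expRD addNr expR0 mulr1.
  have g0 : g 0 <= 2 * `|w 0| ^+ 2.
    have sq i : w 0 0 i ^+ 2 <= `|w 0| ^+ 2.
      by rewrite -real_normK ?num_real// ler_sqr ?nnegrE// ler_norm_coord.
    by rewrite /g mulrDl mul1r lerD.
  apply: (@le_trans _ _ (g 0 * expR (4 * L * d))).
    rewrite ler_pM ?expR_ge0//.
      by rewrite mulr_ge0 ?expR_ge0// addr_ge0 ?sqr_ge0.
    by rewrite ler_expR ler_wpM2l// mulr_ge0.
  rewrite /C /gronwall_const !exprMn -expRM_natl (_ : 2%:R * (2 * L * d) = 4 * L * d); last by ring.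
  rewrite mulrAC (ler_wpM2r (expR_ge0 _))// (le_trans g0)// ler_wpM2r ?sqr_ge0//.
  by rewrite ler_eXnr// ler1n.
suff GP : forall t : R, 0 <= t <= d -> G t <= g 0 by move=> t td; apply/wC/GP.
have G0 : G 0 = g 0 by rewrite /G mulr0 oppr0 expR0 mulr1.
apply: (@real_induction _ 0 d (fun t => G t <= g 0)) => t /andP[t0 td] IH.
  move: t0; rewrite le_eqVlt => /orP[/eqP<-|t0]; first by rewrite G0.
  apply: (continuous_le_left t0) => //.
  exact: is_derive_continuous (dGt _ (ltW t0)).
have Gt : G t <= g 0 by apply: IH; rewrite t0 lexx.
have tin : 0 <= t <= d by rewrite t0 ltW.
(* The bound at time [t] places [v t] strictly inside the ball, so both solutions remain there
   slightly longer. *)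
have vt : `|v t - p| < r.
  rewrite -(subrK (u t) (v t)) -addrA (le_lt_trans (ler_normD _ _))//.
  by rewrite [ltRHS](splitr r) ltr_leD ?ur// (le_lt_trans (wC t tin Gt)).
have utr : `|u t - p| < r by rewrite (le_lt_trans (ur t tin))//; lra.
have nbr x : forward_solution f x -> `|x t - p| < r -> \forall s \near t, `|x s - p| < r.
  move=> fx xr; have cx : {for t, continuous (fun s => `|x s - p|)}.
    apply: cvg_norm; apply: cvgB; last exact: cvg_cst.
    exact: is_derive_continuous (fx t t0).
  exact: (cvgr_lt _ cx).
have /nbhs_ballP[e /= e0 He] : \forall s \near t, `|v s - p| < r /\ `|u s - p| < r.
  by near=> s; split; near: s; apply: nbr.
exists e => // s /andP[ts se] sd.
apply: (le_trans _ Gt); apply: (@le0_is_derive_le _ G dG) => //; first exact: ltW.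
  by move=> t' /andP[tt' _]; apply: dGt; lra.
move=> t' /andP[tt' t's].
have [v' u'] : `|v t' - p| < r /\ `|u t' - p| < r.
  by apply: He; rewrite /ball/= distrC ger0_norm ?subr_ge0//; lra.
rewrite /dG mulr_le0_ge0 ?expR_ge0// subr_le0 /dg.
have B i : 2 * w t' 0 i * (f (v t') - f (u t')) 0 i <= 2 * L * `|w t'| ^+ 2.
  rewrite -!mulrA ler_wpM2l// (le_trans (ler_norm _))// normrM.
  by rewrite expr2 mulrCA ler_pM ?ler_norm_coord// (le_trans (ler_norm_coord _ _))// Lf.
rewrite (le_trans (lerD (B 0) (B 1)))//.
have := ler_wpM2l L0 (w2 t') => ?; lra.
Unshelve. all: by end_near. Qed.

Lemma continuous_dependence (R : realType) (f : 'rV[R]_2 -> 'rV[R]_2) (p : 'rV[R]_2)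
    (r L d : R) (u : R -> 'rV[R]_2) :
  0 < r -> 0 <= L ->
  (forall z z', `|z - p| < r -> `|z' - p| < r -> `|f z - f z'| <= L * `|z - z'|) ->
  forward_solution f u ->
  (forall t, 0 <= t <= d -> `|u t - p| <= r / 2) ->
  forall e, 0 < e -> exists2 e', 0 < e' & forall v, forward_solution f v ->
    `|v 0 - u 0| < e' -> forall t, 0 <= t <= d -> `|v t - u t| < e.
Proof.
move=> r0 L0 Lf fu ur e e0; have C0 := gronwall_const_gt0 L d.
exists (Num.min (r / 2) e / gronwall_const L d).
  by rewrite divr_gt0// lt_min e0 divr_gt0.
move=> v fv; rewrite ltr_pdivlMr// mulrC lt_min => /andP[vr ve] t td.
by apply: le_lt_trans ve; apply: (gronwall r0 L0 Lf).
Qed.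

Lemma locally_lipschitz_ball (R : realType) (V : normedModType R) (f : V -> V) (p : V) :
  locally_lipschitz f -> exists r L : R, [/\ 0 < r, 0 <= L &
    forall z z', `|z - p| < r -> `|z' - p| < r -> `|f z - f z'| <= L * `|z - z'|].
Proof.
move=> /(_ p)[U /nbhs_ballP[r /= r0 rU] [M [_ HM]]].
(* The Lipschitz property holds for all constants above [M]; the maximum with 0 makes the chosen one
   nonnegative. *)
exists r, (Num.max 0 M + 1); split => //.
  by rewrite addr_ge0// le_max lexx.
move=> z z' zp z'p; have /(_ _ (z, z')) := HM (Num.max 0 M + 1); apply => /=.
  by rewrite (@le_lt_trans _ _ (Num.max 0 M))// ?ltrDl// le_max lexx orbT.
by split; apply: rU; rewrite -ball_normE/= distrC.
Qed.

Lemma locally_lipschitz_continuous (R : realType) (V : normedModType R) (f : V -> V) :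
  locally_lipschitz f -> continuous f.
Proof.
move=> lf p; have [r [L [r0 L0 H]]] := locally_lipschitz_ball p lf.
apply/cvgrPdist_lt => e e0; near=> z.
have zp : `|z - p| < r by rewrite distrC; near: z; exact: cvgr_dist_lt.
rewrite distrC (le_lt_trans (H z p zp _)) ?subrr ?normr0//.
have : `|z - p| < e / (L + 1).
  by rewrite distrC; near: z; apply: cvgr_dist_lt => //; rewrite divr_gt0// ltr_wpDl.
rewrite ltr_pdivlMr ?ltr_wpDl// => h; apply: le_lt_trans h.
by rewrite mulrC ler_wpM2l// lerDl.
Unshelve. all: by end_near. Qed.

(** * Uniqueness of solutions, and orbits in a minimal set *)

Section forward.
Context {R : realType} (f : 'rV[R]_2 -> 'rV[R]_2).
Hypothesis lf : locally_lipschitz f.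

Lemma forward_solution_continuous u (t : R) : forward_solution f u -> 0 <= t ->
  {for t, continuous u}.
Proof. by move=> fu /fu/is_derive_continuous. Qed.

(** The time [d] is fixed before the precision [e]: a real induction can advance by [d] and let [e]
    tend to 0 afterwards. *)
Lemma continuous_dependence_near (u : R -> 'rV[R]_2) : forward_solution f u ->
  exists2 d : R, 0 < d & forall e : R, 0 < e -> exists2 e', 0 < e' & forall v, forward_solution f v ->
    `|v 0 - u 0| < e' -> forall t, 0 <= t <= d -> `|v t - u t| < e.
Proof.
move=> fu; have [r [L [r0 L0 H]]] := locally_lipschitz_ball (u 0) lf.
have cu := forward_solution_continuous fu (lexx 0).
have /nbhs_ballP[d /= d0 Hd] : \forall s \near 0, `|u 0 - u s| < r / 2.
  by move: cu => /cvgr_dist_lt; apply; rewrite divr_gt0.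
exists (d / 2); first by rewrite divr_gt0.
apply: (continuous_dependence r0 L0 H fu) => t /andP[t0 td].
rewrite distrC ltW//; apply: Hd; rewrite /ball/= sub0r normrN ger0_norm//.
by rewrite (le_lt_trans td)// ltr_pdivrMr// ltr_pMr// ltr1n.
Qed.

(** Equality passes to left limits by continuity, and shortly after a time of coincidence the
    distance is below every [e]. *)
Lemma forward_solution_unique (u v : R -> 'rV[R]_2) : forward_solution f u ->
  forward_solution f v -> u 0 = v 0 -> forall t, 0 <= t -> u t = v t.
Proof.
move=> fu fv uv0 t t0.
apply: (@real_induction _ 0 t (fun t => u t = v t)); last by rewrite t0 lexx.
- move=> {t0}t /andP[t0 _] IH; move: t0; rewrite le_eqVlt => /orP[/eqP<-//|t0].
  apply/subr0_eq/normr0_eq0/eqP; rewrite eq_le normr_ge0 andbT.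
  apply: (@continuous_le_left _ (fun t => `|u t - v t|) 0 t) => //.
    apply: cvg_norm; apply: cvgB; apply: forward_solution_continuous => //; exact: ltW.
  by move=> s /IH ->; rewrite subrr normr0.
- move=> {t0}t0 /andP[t00 _] IH.
  have fu' := forward_solution_shift t00 fu; have fv' := forward_solution_shift t00 fv.
  have [d d0 Hd] := continuous_dependence_near fu'.
  exists d => // s /andP[ts sd] _.
  apply/subr0_eq/normr0_eq0/eqP; rewrite eq_le normr_ge0 andbT.
  apply/ler_addgt0Pr => e e0; rewrite add0r ltW// distrC.
  have [e' e'0 /(_ _ fv')] := Hd e e0; rewrite !addr0 IH ?t00 ?lexx// subrr normr0.
  move=> /(_ e'0 (s - t0)); rewrite [t0 + _]addrC subrK; apply.
  by rewrite subr_ge0 ltW//= lerBlDl ltW.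
Qed.

(** Over a short time, the solution from a limit point of the tail is a limit of later pieces of
    [x]. Real induction chains these short times, and closedness takes care of left limits. *)
Lemma closure_orbit_invariant (Omega : set 'rV[R]_2) (x : R -> 'rV[R]_2) (T : R) :
  closed Omega -> forward_invariant f Omega -> 0 <= T -> forward_solution f x ->
  (forall t, 0 <= t -> Omega (x t)) ->
  nonempty_closed_invariant f (closure [set x t | t in [set t | T <= t]]) /\
  closure [set x t | t in [set t | T <= t]] `<=` Omega.
Proof.
move=> cO iO T0 fx xO; set M := closure _.
have MO : M `<=` Omega.
  rewrite [X in _ `<=` X]((closure_id Omega).1 cO); apply: closure_subset => _ [t /= Tt <-].
  by apply: xO; exact: le_trans Tt.
split => //; split; [|exact: closed_closure|].
  by exists (x T); apply: subset_closure; exists T => //=.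
move=> z Mz; have [y [/solution_on_forward[u fu uy] y0 _]] := iO z (MO _ Mz).
exists u; split; [exact: forward_solution_on|by rewrite uy|move=> t t0].
apply: (@real_induction _ 0 t (fun t => M (u t))); last by rewrite t0 lexx.
- move=> {t0}t /andP[t0 _] IH; move: t0; rewrite le_eqVlt => /orP[/eqP<-|t0].
    by rewrite uy// y0.
  have cu := forward_solution_continuous fu (ltW t0).
  rewrite (closure_id M).1; last exact: closed_closure.
  move=> B /cu/nbhs_ballP[e /= e0 He].
  pose s := Num.max 0 (t - e / 2).
  have st : s < t by rewrite /s gt_max t0/=; lra.
  have te : t - e / 2 <= s by rewrite /s le_max lexx orbT.
  exists (u s); split; first by apply: IH; rewrite st /s le_max lexx.
  by apply: He; rewrite /ball/= gtr0_norm ?subr_gt0//; lra.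
- move=> {t0}t0 /andP[t00 _] IH.
  have fu' := forward_solution_shift t00 fu.
  have [d d0 Hd] := continuous_dependence_near fu'.
  exists d => // s /andP[ts sd] _.
  move=> B /nbhs_ballP[e /= e0 He].
  have [e' e'0 He'] := Hd e e0.
  have Mt : M (u t0) by apply: IH; rewrite t00 lexx.
  have [_ [[r /= Tr <-]]] := Mt _ (nbhsx_ballx _ _ e'0).
  rewrite -ball_normE/= distrC => xr.
  have r0 := le_trans T0 Tr.
  have := He' _ (forward_solution_shift r0 fx); rewrite !addr0 => /(_ xr (s - t0)).
  rewrite [t0 + _]addrC subrK => h; exists (x (r + (s - t0))); split.
    by exists (r + (s - t0)) => //=; rewrite ler_wpDr// subr_ge0 ltW.
  apply: He; rewrite -ball_normE/= distrC; apply: h.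
  by rewrite subr_ge0 ltW//= lerBlDl ltW.
Qed.

Lemma minimal_set_recurrent (Omega : set 'rV[R]_2) (x : R -> 'rV[R]_2) :
  minimal_set f Omega -> forward_solution f x -> (forall t, 0 <= t -> Omega (x t)) ->
  forall s T e, 0 <= s -> 0 < e -> exists2 t, T <= t & `|x t - x s| < e.
Proof.
move=> [[_ cO iO] mO] fx xO s T e s0 e0.
have T0 : 0 <= Num.max 0 T by rewrite le_max lexx.
have [cM /(mO _ cM) ME] := closure_orbit_invariant cO iO T0 fx xO.
have := xO _ s0; rewrite -ME => /(_ _ (nbhsx_ballx _ _ e0))[_ [[t /= Tt <-]]].
rewrite -ball_normE/= distrC => h; exists t => //.
by rewrite (le_trans _ Tt)// le_max lexx orbT.
Qed.

Lemma minimal_set_stationary (Omega : set 'rV[R]_2) y :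
  minimal_set f Omega -> Omega y -> f y = 0 -> Omega = [set y].
Proof.
move=> [_ mO] Oy fy; apply/esym; apply: mO; last by move=> _ ->.
split; [by exists y|apply: compact_closed; [exact: norm_hausdorff|exact: compact_set1]|move=> _ ->].
by exists (cst y); split => //; apply/forward_solution_on/forward_solution_cst.
Qed.

(** By uniqueness the orbit repeats with period [t - s] from time [s] on. It extends to all times by
    adding enough periods, and the range of the extension is compact and invariant, hence all of
    [Omega] by minimality. *)
Lemma minimal_set_periodic (Omega : set 'rV[R]_2) (x : R -> 'rV[R]_2) (s t : R) :
  minimal_set f Omega -> forward_solution f x -> (forall t, 0 <= t -> Omega (x t)) ->
  0 <= s -> s < t -> x s = x t ->
  exists2 X : R -> 'rV[R]_2, periodic_solution f X & Omega = range X.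
Proof.
move=> [_ mO] fx xO s0 st xst.
pose T := t - s; have T0 : 0 < T by rewrite subr_gt0.
pose y r := x (s + r).
have fy : forward_solution f y by exact: forward_solution_shift.
have yT (r : R) : 0 <= r -> y (r + T) = y r.
  move=> r0; rewrite [r + T]addrC; apply/esym.
  apply: (forward_solution_unique fy (forward_solution_shift (ltW T0) fy)) => //.
  by rewrite /y !addr0 xst addrC subrK.
have ynT (k : nat) (r : R) : 0 <= r -> y (r + k%:R * T) = y r.
  move=> r0; elim: k => [|k IH]; first by rewrite mul0r addr0.
  by rewrite -natr1 mulrDl mul1r addrA yT// addr_ge0// mulr_ge0// ltW.
(* Enough periods to make the shifted time strictly positive, so that the same number still serves
   at all times near [r]. *)
pose n (r : R) : nat := (Num.bound (`|r| / T)).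
have nr r : 0 < r + (n r)%:R * T.
  have : `|r| / T < (n r)%:R by apply: archi_boundP; rewrite divr_ge0// ltW.
  by rewrite ltr_pdivrMr// ltr_norml => /andP[h _]; rewrite -ltrBlDl sub0r ltrNl -ltrNl; lra.
pose X r := y (r + (n r)%:R * T).
(* Any admissible number of periods gives the same value, so [X] is differentiable although [n]
   jumps. *)
have XE (k : nat) r : 0 <= r + k%:R * T -> X r = y (r + k%:R * T).
  have le (i j : nat) : (i <= j)%N -> 0 <= r + i%:R * T -> y (r + j%:R * T) = y (r + i%:R * T).
    move=> ij ri; rewrite -(ynT (j - i)%N (r + i%:R * T))//; congr y.
    by rewrite -addrA -mulrDl -natrD subnKC.
  move=> rk; rewrite /X; have [nk|kn] := leqP (n r) k.
    by rewrite (le _ _ nk)// ltW.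
  by rewrite (le _ _ (ltnW kn)).
have Xy (r : R) : 0 <= r -> X r = y r by move=> r0; rewrite (XE 0%N) mul0r addr0.
have fX (r : R) : is_derive r 1 X (f (X r)).
  have := fy _ (ltW (nr r)); rewrite -/(X r) -{1}(mul1r r) addrC => /is_derive_affine.
  rewrite scale1r; apply: near_eq_is_derive.
  near=> r'; rewrite mul1r addrC -XE// ltW//.
  suff : - ((n r)%:R * T) < r' by rewrite -subr_gt0 opprK addrC.
  near: r'; apply: lt_nbhsr; rewrite -subr_gt0 opprK; exact: nr.
have rX : range X = y @` `[0, T].
  apply/seteqP; split=> [_ [r _ <-]|_ [r /= + <-]]; last first.
    by rewrite in_itv/= => /andP[r0 _]; exists r => //; exact: Xy.
  (* Reduction modulo [T]: subtracting [m] whole periods brings the time into [[0, T]]. *)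
  have /andP[m1 m2] := truncn_itv (divr_ge0 (ltW (nr r)) (ltW T0)).
  set m := Num.truncn _ in m1 m2.
  rewrite ler_pdivlMr// in m1; rewrite ltr_pdivrMr// in m2.
  exists (r + (n r)%:R * T - m%:R * T) => /=.
    by rewrite in_itv/= subr_ge0 m1/= lerBlDr (le_trans (ltW m2))// -natr1 mulrDl mul1r addrC.
  by rewrite -(ynT m) ?subr_ge0// subrK.
exists X.
  split; first by apply/solution_on_setT.
  exists T => // r; have := nr r => h.
  by rewrite (XE (n r)) addrAC ?yT// ?ltW// addr_gt0.
apply/esym/mO; last first.
  by move=> _ [r _ <-]; apply: xO; rewrite addr_ge0// ltW.
split; first by exists (X 0), 0.
  rewrite rX; apply: compact_closed; [exact: norm_hausdorff|]; apply: continuous_compact; last exact: segment_compact.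
  apply: continuous_in_subspaceT => r; rewrite inE/= in_itv/= => /andP[r0 _].
  exact: forward_solution_continuous.
move=> _ [r _ <-]; exists (fun t => X (r + t)); split; [|by rewrite addr0|by move=> t' _; exists (r + t')].
apply: forward_solution_on => r' _; have := fX (r + r').
rewrite -{1}(mul1r r') => /is_derive_affine; rewrite scale1r.
by under eq_fun do rewrite mul1r.
Unshelve. all: by end_near. Qed.
End forward.

(** * Smooth bumps with explicit antiderivatives *)

Section clamp.
Context {R : realType}.

(** The projection onto [[- e, e]]: a polynomial composed with it becomes constant on each side of
    this interval. *)
Definition clamp (e u : R) := Num.max (- e) (Num.min e u).

Lemma clamp_id e u : `|u| <= e -> clamp e u = u.
Proof. by rewrite ler_norml => /andP[h1 h2]; rewrite /clamp (min_idPr h2) (max_idPr h1). Qed.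

Lemma clamp_ge e u : 0 < e -> e <= u -> clamp e u = e.
Proof. by move=> e0 eu; rewrite /clamp (min_idPl eu) (max_idPr _)//; lra. Qed.

Lemma clamp_le e u : 0 < e -> u <= - e -> clamp e u = - e.
Proof. by move=> e0 eu; rewrite /clamp (max_idPl _)// ge_min eu orbT. Qed.

Lemma clamp_norm e u : 0 < e -> `|clamp e u| <= e.
Proof.
move=> e0; have [h|h] := leP `|u| e; first by rewrite clamp_id.
move: h; rewrite ltr_normr => /orP[/ltW h|h]; first by rewrite clamp_ge// gtr0_norm.
by rewrite clamp_le// ?normrN ?gtr0_norm// ltW// ltrNr.
Qed.

(** From an endpoint, a displacement shorter than [e] can leave the interval only on the side of
    that endpoint. *)
Lemma clamp_overflow e u h : 0 < e -> `|u| = e -> `|h| < e -> e < `|h + u| ->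
  clamp e (h + u) = u.
Proof.
move=> e0 ue; rewrite ltr_norml ltr_normr => /andP[h1 h2] /orP h3.
have [u0|u0] := leP 0 u.
  have {}ue : u = e by rewrite -ue ger0_norm.
  case: h3 => h3; last by lra.
  by rewrite clamp_ge ?(ltW h3).
have {}ue : u = - e by rewrite -ue ltr0_norm// opprK.
case: h3 => h3; first by lra.
by rewrite clamp_le// ltW// ltrNr.
Qed.

Lemma continuous_clamp e : continuous (clamp e).
Proof.
move=> u; apply: (@continuous_max _ _ (cst (- e)) (fun u => Num.min e u)); first exact: cvg_cst.
by apply: (@continuous_min _ _ (cst e) id); [exact: cvg_cst|exact: cvg_id].
Qed.

(** At an endpoint the difference quotient is either the one of [q] or zero, and both tend to 0
    since [q'] vanishes there. *)
Lemma is_derive_clamp (q q' : R -> R) (e : R) : 0 < e ->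
  (forall u : R, is_derive u 1 q (q' u)) -> q' e = 0 -> q' (- e) = 0 ->
  forall u : R, is_derive u 1 (q \o clamp e) (q' (clamp e u)).
Proof.
move=> e0 dq qe qNe u.
have [ue|eu|ue] := ltgtP `|u| e.
- rewrite clamp_id ?(ltW ue)//; apply: near_eq_is_derive (dq u).
  near=> v; rewrite /= clamp_id// ltW//; near: v.
  exact: (cvgr_lt _ (@norm_continuous _ R^o u)).
- have [u0|u0] := leP 0 u.
    rewrite ger0_norm// in eu; rewrite clamp_ge ?ltW// qe.
    apply: near_eq_is_derive (is_derive_cst (q e) u 1).
    by near=> v; rewrite /= clamp_ge// ltW//; near: v; exact: lt_nbhsr.
  rewrite ltr0_norm// in eu; rewrite clamp_le ?ltW 1?ltrNr// qNe.
  apply: near_eq_is_derive (is_derive_cst (q (- e)) u 1).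
  by near=> v; rewrite /= clamp_le// ltW//; near: v; apply: lt_nbhsl; rewrite ltrNr.
have cu : clamp e u = u by rewrite clamp_id ?ue.
have qu : q' u = 0.
  by move: ue; have [u0|u0] := leP 0 u; [rewrite ger0_norm// => ->|rewrite ltr0_norm// => h; rewrite -qNe -h opprK].
rewrite cu qu.
have D : h^-1 *: (q (h *: 1 + u) - q u) @[h --> 0^'] --> 0.
  by have [du qv] := dq u; rewrite -[X in _ --> X]qu -[X in _ --> X]qv; exact: du.
suff D' : h^-1 *: ((q \o clamp e) (h *: 1 + u) - (q \o clamp e) u) @[h --> 0^'] --> 0.
  by apply: DeriveDef; [apply/cvg_ex; exists 0|exact: cvg_lim D'].
apply/cvgr0Pnorm_lt => d d0; near=> h; rewrite /= cu.
have hd : `|h^-1 *: (q (h *: 1 + u) - q u)| < d by near: h; exact: cvgr0_norm_lt.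
have he : `|h| < e by near: h; exact: dnbhs0_lt.
have [hu|] := leP `|h *: 1 + u| e; first by rewrite clamp_id.
rewrite [h *: 1]mulr1 => /(clamp_overflow e0 ue he) ->.
by rewrite subrr scaler0 normr0.
Unshelve. all: by end_near. Qed.

End clamp.

Section bump.
Context {R : realType}.

(** [bump] and [step] are the [a] and [A] of the introduction: [bump] is [(e ^+ 2 - u ^+ 2) ^+ 2] on
    [[- e, e]] and 0 outside, and [step] is its odd primitive. The outer square makes [bump]
    continuously differentiable. *)
Let step_poly (e u : R) := e ^+ 4 * u - 2 / 3 * e ^+ 2 * u ^+ 3 + u ^+ 5 / 5.
Let bump_poly (e u : R) := (e ^+ 2 - u ^+ 2) ^+ 2.
Let dbump_poly (e u : R) := - (4 * u * (e ^+ 2 - u ^+ 2)).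

Definition step (e : R) := step_poly e \o clamp e.
Definition bump (e : R) := bump_poly e \o clamp e.
Definition dbump (e : R) := dbump_poly e \o clamp e.

Lemma is_derive_step (e u : R) : 0 < e -> is_derive u 1 (step e) (bump e u).
Proof.
move=> e0; apply: (@is_derive_clamp _ _ (bump_poly e)) => //; rewrite /bump_poly.
- move=> v; have -> : step_poly e = e ^+ 4 \*: id - (2 / 3 * e ^+ 2) \*: (id ^+ 3) + 5^-1 \*: (id ^+ 5).
    by apply/funext => w; rewrite /step_poly/= [w ^+ 5 / 5]mulrC.
  by apply: is_derive_eq; rewrite -![_ *: _]/(_ * _)/=; field.
- by rewrite subrr expr0n.
- by rewrite sqrrN subrr expr0n.
Qed.

Lemma is_derive_bump (e u : R) : 0 < e -> is_derive u 1 (bump e) (dbump e u).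
Proof.
move=> e0; apply: (@is_derive_clamp _ _ (dbump_poly e)) => //; rewrite /dbump_poly.
- move=> v; have -> : bump_poly e = (cst (e ^+ 2) - id ^+ 2) ^+ 2 by apply/funext.
  apply: is_derive_eq; rewrite -![_ *: _]/(_ * _)/= !fctE; ring.
- by rewrite subrr mulr0 oppr0.
- by rewrite sqrrN subrr mulr0 oppr0.
Qed.

Lemma continuous_dbump e : continuous (dbump e).
Proof.
move=> u; apply: (@continuous_comp _ _ _ (clamp e) (dbump_poly e)); first exact: continuous_clamp.
apply: cvgN; apply: cvgM; first by apply: cvgM; [exact: cvg_cst|exact: cvg_id].
by apply: cvgB; [exact: cvg_cst|apply: cvgM; exact: cvg_id].
Qed.

Lemma bump_ge0 e u : 0 <= bump e u.
Proof. exact: sqr_ge0. Qed.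

Lemma bump_gt0 e u : `|u| < e -> 0 < bump e u.
Proof.
move=> ue; rewrite /bump/= clamp_id ?(ltW ue)// /bump_poly.
have e0 : 0 < e by rewrite (le_lt_trans _ ue).
by rewrite exprn_gt0// subr_gt0 -real_normK ?num_real// ltr_sqr ?nnegrE// ltW.
Qed.

Lemma bump_eq0 e u : 0 < e -> e <= `|u| -> bump e u = 0.
Proof.
move=> e0; rewrite ler_normr => /orP[h|h]; rewrite /bump/= /bump_poly.
  by rewrite clamp_ge// subrr expr0n.
by rewrite clamp_le ?sqrrN ?subrr ?expr0n// lerNr.
Qed.

Lemma bump_bounded e : 0 < e ->
  exists M, forall u, [/\ `|step e u| <= M, `|bump e u| <= M & `|dbump e u| <= M].
Proof.
move=> e0.
(* The sum of the three separate bounds; the first one rests on [1 + 2 / 3 + 1 / 5 <= 2]. *)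
exists (e ^+ 5 * 2 + e ^+ 4 + 4 * e ^+ 3) => u.
rewrite /step /bump /dbump /=; have := clamp_norm u e0.
move: (clamp e u) => v ve.
have e0w := ltW e0.
have vX k : `|v| ^+ k <= e ^+ k by rewrite lerXn2r// ?nnegrE// ltW.
have eX k : 0 <= e ^+ k by rewrite exprn_ge0// ltW.
have w2 : 0 <= e ^+ 2 - v ^+ 2 <= e ^+ 2.
  by rewrite subr_ge0 lerBlDr lerDl sqr_ge0 -real_normK ?num_real// vX.
split.
- have -> : e ^+ 5 * 2 + e ^+ 4 + 4 * e ^+ 3 = e ^+ 4 * e + 2 / 3 * e ^+ 2 * e ^+ 3 + e ^+ 5 / 5 +
     (2 / 15 * e ^+ 5 + e ^+ 4 + 4 * e ^+ 3) by field.
  rewrite ler_wpDr ?addr_ge0 ?mulr_ge0 ?invr_ge0 //.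
  rewrite /step_poly (le_trans (ler_normD _ _))// lerD//; last first.
    by rewrite normrM normrX [ `|5^-1| ]ger0_norm ?invr_ge0// ler_wpM2r ?vX ?invr_ge0.
  rewrite (le_trans (ler_normB _ _))// lerD//.
    by rewrite normrM ger0_norm// ler_wpM2l.
  by rewrite normrM normrX ger0_norm ?mulr_ge0 ?divr_ge0// ler_wpM2l ?mulr_ge0 ?divr_ge0.
- rewrite ger0_norm ?sqr_ge0// /bump_poly.
  have -> : e ^+ 4 = (e ^+ 2) ^+ 2 by rewrite -exprM.
  rewrite (@le_trans _ _ ((e ^+ 2) ^+ 2))//; last by rewrite -addrA addrCA lerDl addr_ge0 ?mulr_ge0.
  by case/andP: w2 => ? ?; rewrite lerXn2r// nnegrE (le_trans _ (eX 2)).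
- rewrite /dbump_poly normrN !normrM ger0_norm// [ `|e ^+ 2 - _| ]ger0_norm; last by case/andP: w2.
  rewrite ler_wpDl ?addr_ge0 ?mulr_ge0// -mulrA ler_wpM2l// exprS.
  by case/andP: w2 => ? ?; rewrite ler_pM.
Qed.

End bump.

(** * Integrals depending on a parameter, integrals of derivatives, positivity *)

Section integral.
Context {R : realType}.
Notation mu := (@lebesgue_measure R).

(** Domination by the constant [M] on the time window justifies differentiating under the
    integral. *)
Lemma is_derive_Rintegral (g h : R -> R -> R) (t a b u v M : R) : u < t < v ->
  (forall t, u < t < v -> {within `[a, b], continuous (g t)}) ->
  (forall t s, u < t < v -> a <= s <= b -> is_derive t 1 (g ^~ s) (h t s)) ->
  (forall t s, u < t < v -> a <= s <= b -> `|h t s| <= M) ->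
  is_derive t 1 (fun t => \int[mu]_(s in `[a, b]) g t s) (\int[mu]_(s in `[a, b]) h t s).
Proof.
move=> tuv cg dg hM.
have It : `]u, v[%classic t by rewrite /= in_itv.
have intg x : `]u, v[%classic x -> mu.-integrable `[a, b] (EFin \o g x).
  rewrite /= in_itv/= => xuv; apply: continuous_compact_integrable; first exact: segment_compact.
  exact: cg.
have dg1 x y : `]u, v[%classic x -> `[a, b]%classic y -> derivable (g ^~ y) x 1.
  by rewrite /= !in_itv/= => xuv yab; have [] := dg _ _ xuv yab.
have p1 x y : `]u, v[%classic x -> `[a, b]%classic y -> partial1of2 g x y = h x y.
  rewrite /= !in_itv/= => xuv yab; rewrite partial1of2E; by have [_] := dg _ _ xuv yab.
have iM : mu.-integrable `[a, b] (EFin \o (fun _ : R => `|M|)).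
  apply: continuous_compact_integrable; first exact: segment_compact.
  by apply: continuous_subspaceT => x; exact: cvg_cst.
have hb x y : `]u, v[%classic x -> `[a, b]%classic y -> `|partial1of2 g x y| <= `|M|.
  move=> xuv yab; rewrite p1//; move: xuv yab; rewrite /= !in_itv/= => xuv yab.
  by rewrite (le_trans (hM _ _ xuv yab))// ler_norm.
have mab : measurable (`[a, b] : set R) by [].
split.
  exact: (@derivable_under_integral _ _ _ mu g `[a, b] mab t u v It intg dg1 _ (fun=> normr_ge0 M) iM hb).
rewrite -derive1E (@differentiation_under_integral _ _ _ mu g `[a, b] mab t u v It intg dg1 _ (fun=> normr_ge0 M) iM hb).
by apply: eq_Rintegral => s; rewrite inE => sab; rewrite -p1.
Qed.

Lemma Rintegral_derive (F f : R -> R) (a b : R) : a < b ->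
  (forall s, a <= s <= b -> is_derive s 1 F (f s)) ->
  {within `[a, b], continuous f} ->
  \int[mu]_(s in `[a, b]) f s = F b - F a.
Proof.
move=> ab dF cf.
have cF s : a <= s <= b -> {for s, continuous F} by move=> /dF/is_derive_continuous.
rewrite /Rintegral (@continuous_FTC2 _ f F)//.
- split.
  + by move=> s; rewrite in_itv/= => /andP[/ltW h1 /ltW h2]; case: (dF s); rewrite ?h1.
  + by apply: cvg_at_right_filter; apply: cF; rewrite lexx ltW.
  + by apply: cvg_at_left_filter; apply: cF; rewrite lexx ltW.
- move=> s; rewrite in_itv/= => /andP[/ltW h1 /ltW h2]; rewrite derive1E.
  by case: (dF s) => //; rewrite h1.
Qed.

(** By continuity the integrand exceeds [f s / 2] on an interval around [s], which bounds the
    integral below. *)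
Lemma Rintegral_gt0 (f : R -> R) (a b s : R) : a < s < b ->
  {within `[a, b], continuous f} -> {for s, continuous f} ->
  (forall t, a <= t <= b -> 0 <= f t) -> 0 < f s ->
  0 < \int[mu]_(t in `[a, b]) f t.
Proof.
move=> /andP[as_ sb] cf cs f0 fs.
have if_ : mu.-integrable `[a, b] (EFin \o f).
  by apply: continuous_compact_integrable => //; exact: segment_compact.
have /nbhs_ballP[d /= d0 Hd] : \forall t \near s, f s / 2 < f t.
  by apply: (cvgr_gt _ cs); rewrite ltr_pdivrMr// ltr_pMr// ltr1n.
pose e := Num.min (d / 2) (Num.min (s - a) (b - s)).
have e0 : 0 < e by rewrite /e !lt_min !subr_gt0 as_ sb divr_gt0.
have ed : e <= d / 2 by rewrite /e ge_min lexx.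
have ea : e <= s - a by rewrite /e !ge_min lexx orbT.
have eb : e <= b - s by rewrite /e !ge_min lexx !orbT.
have sub : `[s - e, s + e] `<=` (`[a, b] : set R).
  by move=> x /=; rewrite !in_itv/= => /andP[h1 h2]; apply/andP; split; lra.
have ie : mu.-integrable `[s - e, s + e] (EFin \o f) by apply: integrableS if_.
apply: (@lt_le_trans _ _ (\int[mu]_(t in `[s - e, s + e]) f t)); last first.
  apply: fine_le; [exact: integrable_fin_num..|].
  apply: ge0_subset_integral => //; first exact: (measurable_int mu).
apply: (@lt_le_trans _ _ (\int[mu]_(t in `[s - e, s + e]) (cst (f s / 2) t))).
  rewrite Rintegral_cst//.
  have /= -> := lebesgue_measure_itv `[s - e, s + e].
  rewrite lte_fin; case: ifP => h; last by move: h; lra.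
  by rewrite /= mulr_gt0 ?divr_gt0//; lra.
apply: le_Rintegral => //.
  apply: continuous_compact_integrable; first exact: segment_compact.
  by apply: continuous_subspaceT => x; exact: cvg_cst.
move=> x; rewrite /= in_itv/= => /andP[h1 h2]; apply/ltW/Hd.
by rewrite /ball/= ltr_norml; apply/andP; split; lra.
Qed.

End integral.

(** * Mollified intersection number of plane curves *)

Section curves.
Context {R : realType}.
Notation mu := (@lebesgue_measure R).
Implicit Types (c d : R -> 'rV[R]_2) (z w : 'rV[R]_2).

(** Positivity of [s] is an open condition, which leaves room on both sides of each time; all curves
    below are run over intervals of positive times. *)
Definition C1_curve c c' := forall s : R, 0 < s ->
  is_derive s 1 c (c' s) /\ {for s, continuous c'}.

Definition det2 z w := z 0 0 * w 0 1 - z 0 1 * w 0 0.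

Definition bump2 (e : R) z := bump e (z 0 0) * bump e (z 0 1).

(** The share of one arc in the function [N] of the introduction, for the smoothing radius [e]. *)
Definition flux (e : R) c c' (a b : R) z :=
  \int[mu]_(s in `[a, b]) (step e ((c s - z) 0 0) * bump e ((c s - z) 0 1) * c' s 0 1).

(** The mollified rate of signed intersections of the arc with a curve passing through [z] at
    velocity [w]. *)
Definition crossing (e : R) c c' (a b : R) z w :=
  \int[mu]_(s in `[a, b]) (bump2 e (c s - z) * det2 (c' s) w).

Lemma continuous_coord (c : R -> 'rV[R]_2) (i : 'I_2) (s : R) : {for s, continuous c} ->
  {for s, continuous (fun s => c s 0 i)}.
Proof. by move=> cc; apply: (@continuous_comp _ _ _ c (fun w => w 0 i)) => //; exact: coord_continuous. Qed.

Lemma C1_curve_bounded c c' (a b : R) : C1_curve c c' -> 0 < a ->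
  exists2 K, 0 <= K & forall s, a <= s <= b -> `|c' s| <= K.
Proof.
move=> cc a0.
have : compact (c' @` `[a, b]).
  apply: continuous_compact; last exact: segment_compact.
  apply: continuous_in_subspaceT => s; rewrite inE/= in_itv/= => /andP[as_ _].
  by apply: (cc s _).2; exact: lt_le_trans as_.
move=> /compact_bounded[M [_ HM]].
exists (Num.max 0 M + 1); first by rewrite addr_ge0// le_max lexx.
move=> s sab; apply: (HM (Num.max 0 M + 1)).
  by rewrite (@le_lt_trans _ _ (Num.max 0 M)) ?ltrDl// le_max lexx orbT.
by exists s => //=; rewrite in_itv.
Qed.

Lemma continuous_is_derive1 (f f' : R -> R) : (forall u : R, is_derive u 1 f (f' u)) -> continuous f.
Proof. by move=> H u; apply: is_derive_continuous (H u). Qed.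

Lemma continuous_shift_coord c c' z i (s : R) (g : R -> R) : C1_curve c c' -> 0 < s -> continuous g ->
  {for s, continuous (fun s => g ((c s - z) 0 i))}.
Proof.
move=> cc s0 cg; apply: (@continuous_comp _ _ _ (fun s => (c s - z) 0 i) g); last exact: cg.
apply: (@continuous_coord (fun s => c s - z)); apply: cvgB; last exact: cvg_cst.
by apply: is_derive_continuous (cc s s0).1.
Qed.

Lemma is_derive_shift_coord c c' z i (s : R) (g g' : R -> R) : C1_curve c c' -> 0 < s ->
  (forall u : R, is_derive u 1 g (g' u)) ->
  is_derive s 1 (fun s => g ((c s - z) 0 i)) (g' ((c s - z) 0 i) * c' s 0 i).
Proof.
move=> cc s0 dg; apply: (@is_derive1_comp _ g (fun s => (c s - z) 0 i)).
apply: (@is_derive_coord _ _ _ (fun s => c s - z)).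
have dc := (cc s s0).1.
by apply: (is_derive_eq (is_deriveB dc (is_derive_cst z s 1))); rewrite subr0.
Qed.

Lemma is_derive_coord_shift d d' z i (t : R) (g g' : R -> R) : C1_curve d d' -> 0 < t ->
  (forall u : R, is_derive u 1 g (g' u)) ->
  is_derive t 1 (fun t => g ((z - d t) 0 i)) (- (g' ((z - d t) 0 i) * d' t 0 i)).
Proof.
move=> dd t0 dg; rewrite -mulrN; apply: (@is_derive1_comp _ g (fun t => (z - d t) 0 i)).
rewrite -[- _]/(- (fun A : 'M[R]_(1,2) => A 0 i) (d' t)).
have := @is_derive_coord _ _ _ (fun t => z - d t) (- d' t) t 0 i.
rewrite mxE; apply.
have dc := (dd t t0).1.
by apply: (is_derive_eq (is_deriveB (is_derive_cst z t 1) dc)); rewrite sub0r.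
Qed.

Lemma continuous_crossing_integrand (e : R) c c' z w (s : R) : 0 < e -> C1_curve c c' -> 0 < s ->
  {for s, continuous (fun s => bump2 e (c s - z) * det2 (c' s) w)}.
Proof.
move=> e0 cc s0; have cb := continuous_is_derive1 (fun u => is_derive_bump u e0).
apply: cvgM; first by apply: cvgM; apply: (@continuous_shift_coord c c' _ _ _ (bump e)).
by apply: cvgB; (apply: cvgM; last exact: cvg_cst); apply: continuous_coord; exact: (cc s s0).2.
Qed.

Lemma C1_within (g : R -> R) (a b : R) : 0 < a -> (forall s, 0 < s -> {for s, continuous g}) ->
  {within `[a, b], continuous g}.
Proof.
move=> a0 H; apply: continuous_in_subspaceT => s; rewrite inE/= in_itv/= => /andP[as_ _].
by apply: H; exact: lt_le_trans as_.
Qed.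

(** Differentiating the integrand in [t] gives the integrand of [crossing] minus the derivative of
    [P] along the arc. For a given [t], the boundary terms depend only on the endpoints of the arc,
    so they cancel over a closed curve. *)
Lemma is_derive_flux (e : R) c c' d d' (a b t : R) : 0 < e -> 0 < a -> a < b -> 0 < t ->
  C1_curve c c' -> C1_curve d d' ->
  let P s := step e ((c s - d t) 0 0) * bump e ((c s - d t) 0 1) * d' t 0 1 in
  is_derive t 1 (fun t => flux e c c' a b (d t))
    (crossing e c c' a b (d t) (d' t) - (P b - P a)).
Proof.
move=> e0 a0 ab t0 cc dd P.
have ds u := is_derive_step u e0; have db u := is_derive_bump u e0.
have cs := continuous_is_derive1 ds; have cb := continuous_is_derive1 db.
have [K K0 HK] := C1_curve_bounded b cc a0.
(* The window from [t / 2] to [t * 2] keeps times positive and bounds [d'], which provides the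
   domination. *)
have t20 : 0 < t / 2 by rewrite divr_gt0.
have [K' K'0 HK'] := C1_curve_bounded (t * 2) dd t20.
have [M HM] := bump_bounded e0.
have M0 : 0 <= M by have [h _ _] := HM 0; rewrite (le_trans _ h).
pose g (t s : R) := step e ((c s - d t) 0 0) * bump e ((c s - d t) 0 1) * c' s 0 1.
pose h (t s : R) := - (bump e ((c s - d t) 0 0) * d' t 0 0 * bump e ((c s - d t) 0 1) +
   step e ((c s - d t) 0 0) * (dbump e ((c s - d t) 0 1) * d' t 0 1)) * c' s 0 1.
have tt : t / 2 < t < t * 2 by apply/andP; split; lra.
have cg : forall t', t / 2 < t' < t * 2 -> {within `[a, b], continuous (g t')}.
  move=> t' _; apply: C1_within => // s s0; apply: cvgM.
    apply: cvgM; first by apply: (@continuous_shift_coord c c' _ _ _ (step e)).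
    by apply: (@continuous_shift_coord c c' _ _ _ (bump e)).
  by apply: continuous_coord; exact: (cc s s0).2.
have dg : forall t' s, t / 2 < t' < t * 2 -> a <= s <= b -> is_derive t' 1 (g ^~ s) (h t' s).
  move=> t' s /andP[t't _] /andP[as_ sb].
  have t'0 : 0 < t' by lra.
  have d1 := is_derive_coord_shift (c s) 0 dd t'0 ds.
  have d2 := is_derive_coord_shift (c s) 1 dd t'0 db.
  have d3 := is_derive_cst (c' s 0 1) t' 1.
  apply: (is_derive_eq (is_deriveM (is_deriveM d1 d2) d3)).
  rewrite -![_ *: _]/(_ * _) /h/=; ring.
have aux (x1 x2 x3 x4 y1 y2 y3 : R) : `|x1| <= M -> `|x2| <= M -> `|x3| <= M ->
    `|x4| <= M -> `|y1| <= K' -> `|y2| <= K' -> `|y3| <= K ->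
    `|- (x2 * y1 * x3 + x1 * (x4 * y2)) * y3| <= (M * K' * M + M * (M * K')) * K.
  move=> *; rewrite normrM normrN ler_pM// (le_trans (ler_normD _ _))// !normrM lerD//.
    by rewrite !ler_pM ?mulr_ge0.
  by rewrite !ler_pM ?mulr_ge0.
have hM : forall t' s, t / 2 < t' < t * 2 -> a <= s <= b -> `|h t' s| <= (M * K' * M + M * (M * K')) * K.
  move=> t' s /andP[t't tt'] /HK sab.
  have [s1 b1 _] := HM ((c s - d t') 0 0); have [_ b2 db2] := HM ((c s - d t') 0 1).
  have kk i : `|d' t' 0 i| <= K'.
    by rewrite (le_trans (ler_norm_coord _ _))// HK'// !ltW.
  have k0 := kk 0; have k1 := kk 1.
  have c1K : `|c' s 0 1| <= K by rewrite (le_trans (ler_norm_coord _ _)).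
  exact: (aux _ _ _ _ _ _ _ s1 b1 b2 db2 k0 k1 c1K).
have D := is_derive_Rintegral tt cg dg hM.
apply: (is_derive_eq D).
pose P' s := (bump e ((c s - d t) 0 0) * c' s 0 0 * bump e ((c s - d t) 0 1) +
   step e ((c s - d t) 0 0) * (dbump e ((c s - d t) 0 1) * c' s 0 1)) * d' t 0 1.
have cP' s : 0 < s -> {for s, continuous P'}.
  move=> s0; have cc' i : {for s, continuous (fun s => c' s 0 i)}.
    by apply: continuous_coord; exact: (cc s s0).2.
  apply: cvgM; last exact: cvg_cst.
  apply: cvgD.
    apply: cvgM; last by apply: (@continuous_shift_coord c c' _ _ _ (bump e)).
    by apply: cvgM; [apply: (@continuous_shift_coord c c' _ _ _ (bump e))|exact: cc'].
  apply: cvgM; first by apply: (@continuous_shift_coord c c' _ _ _ (step e)).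
  apply: cvgM; last exact: cc'.
  by apply: (@continuous_shift_coord c c' _ _ _ (dbump e)) => //; exact: continuous_dbump.
have dP s : a <= s <= b -> is_derive s 1 P (P' s).
  move=> /andP[as_ _]; have s0 := lt_le_trans a0 as_.
  have d1 := is_derive_shift_coord (d t) 0 cc s0 ds.
  have d2 := is_derive_shift_coord (d t) 1 cc s0 db.
  have d3 := is_derive_cst (d' t 0 1) s 1.
  apply: (is_derive_eq (is_deriveM (is_deriveM d1 d2) d3)).
  rewrite -![_ *: _]/(_ * _) /P'/=; ring.
rewrite -(@Rintegral_derive _ P P')//; last exact: C1_within.
rewrite /crossing -RintegralB//; last 2 first.
- apply: continuous_compact_integrable; first exact: segment_compact.
  by apply: C1_within => // s s0; exact: continuous_crossing_integrand.
- apply: continuous_compact_integrable; first exact: segment_compact.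
  exact: C1_within.
apply: eq_Rintegral => s _; rewrite /h /P' /bump2 /det2; ring.
Qed.

End curves.

(** A nonnegative derivative gives monotonicity, and just to the right of [s] the positive
    difference quotient gives a strict increase. *)
Lemma is_derive_gt0_lt (R : realType) (G dG : R -> R) (a b s : R) : a <= s < b ->
  (forall t, a <= t <= b -> is_derive t 1 G (dG t)) ->
  (forall t, a <= t <= b -> 0 <= dG t) -> 0 < dG s -> G a < G b.
Proof.
move=> /andP[as_ sb] D N Ns.
have mono t t' : a <= t -> t <= t' -> t' <= b -> G t <= G t'.
  move=> at_ tt' t'b; rewrite -lerN2.
  apply: (@le0_is_derive_le _ (fun t => - G t) (fun t => - dG t)) => // r /andP[h1 h2].
    apply: is_deriveN; apply: D; by rewrite (le_trans at_ h1) (le_trans h2).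
  by rewrite oppr_le0 N// (le_trans at_ h1) (le_trans h2).
have sab : a <= s <= b by rewrite as_ ltW.
apply: (le_lt_trans (mono a s _ _ _)) => //; first exact: ltW.
have Q : h^-1 *: (G (h *: 1 + s) - G s) @[h --> 0^'] --> dG s.
  by have [dg gv] := D s sab; rewrite -[X in _ --> X]gv; exact: dg.
have bs : 0 < b - s by rewrite subr_gt0.
have [e /= e0 He] : \forall h \near (0 : R)^', 0 < h^-1 *: (G (h *: 1 + s) - G s) := cvgr_gt _ Q _ Ns.
pose h := Num.min (e / 2) (b - s).
have h0 : 0 < h by rewrite lt_min bs divr_gt0.
have he : h <= e / 2 by rewrite ge_min lexx.
have hb : h <= b - s by rewrite ge_min lexx orbT.
have : 0 < h^-1 * (G (h + s) - G s).
  have := He h; rewrite /= [h *: 1]mulr1; apply; last exact: lt0r_neq0.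
  by rewrite /ball/= sub0r normrN gtr0_norm//; lra.
rewrite pmulr_rgt0 ?invr_gt0// subr_gt0 => /lt_le_trans; apply.
by apply: mono => //; lra.
Qed.

(** * Signs of crossings, and closed curves made of two arcs *)

Section curves.
Context {R : realType}.
Notation mu := (@lebesgue_measure R).
Implicit Types (c d : R -> 'rV[R]_2) (z w : 'rV[R]_2).

Lemma bump2_eq0 (e : R) z : 0 < e -> e <= `|z| -> bump2 e z = 0.
Proof.
move=> e0 ez; rewrite /bump2.
have [z0|z0] := leP e `|z 0 0|; first by rewrite bump_eq0// mul0r.
have [z1|z1] := leP e `|z 0 1|; first by rewrite (bump_eq0 _ z1)// mulr0.
by have := norm_ltP e0 z0 z1; rewrite ltNge ez.
Qed.

Lemma bump2_ge0 (e : R) z : 0 <= bump2 e z.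
Proof. by rewrite mulr_ge0// bump_ge0. Qed.

Lemma bump2_gt0 (e : R) z : `|z| < e -> 0 < bump2 e z.
Proof. by move=> ze; rewrite mulr_gt0// bump_gt0// (le_lt_trans _ ze)// ler_norm_coord. Qed.

Lemma crossingZ (e l : R) c c' (a b : R) z w : 0 < e -> 0 < a -> C1_curve c c' ->
  l * crossing e c c' a b z w = \int[mu]_(s in `[a, b]) (l * (bump2 e (c s - z) * det2 (c' s) w)).
Proof.
move=> e0 a0 cc; rewrite -RintegralZl//.
apply: continuous_compact_integrable; first exact: segment_compact.
by apply: C1_within => // s s0; exact: continuous_crossing_integrand.
Qed.

(** The factor [l] carries the orientation, so that one statement covers both signs. Only points of
    the arc within [e] of [z] contribute, since [bump2] vanishes elsewhere. *)
Lemma crossing_ge0 (e l : R) c c' (a b : R) z w : 0 < e -> 0 < a -> C1_curve c c' ->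
  (forall s, a <= s <= b -> `|c s - z| < e -> 0 <= l * det2 (c' s) w) ->
  0 <= l * crossing e c c' a b z w.
Proof.
move=> e0 a0 cc H; rewrite crossingZ//; apply: Rintegral_ge0 => s /=.
rewrite in_itv/= => sab; rewrite mulrCA.
have [h|h] := leP e `|c s - z|; first by rewrite bump2_eq0// mul0r.
by rewrite mulr_ge0 ?bump2_ge0// H.
Qed.

Lemma crossing_gt0 (e l : R) c c' (a b s : R) z w : 0 < e -> 0 < a -> a < s < b -> C1_curve c c' ->
  (forall s, a <= s <= b -> `|c s - z| < e -> 0 <= l * det2 (c' s) w) ->
  `|c s - z| < e -> 0 < l * det2 (c' s) w ->
  0 < l * crossing e c c' a b z w.
Proof.
move=> e0 a0 sab cc H cse ls; rewrite crossingZ//.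
have ct s' : 0 < s' -> {for s', continuous (fun s => l * (bump2 e (c s - z) * det2 (c' s) w))}.
  by move=> s'0; apply: cvgM; [exact: cvg_cst|exact: continuous_crossing_integrand].
apply: (@Rintegral_gt0 _ _ a b s) => //.
- exact: C1_within.
- by apply: ct; case/andP: sab => /(lt_trans a0).
- move=> t tab; rewrite mulrCA.
  have [h|h] := leP e `|c t - z|; first by rewrite bump2_eq0// mul0r.
  by rewrite mulr_ge0 ?bump2_ge0// H.
- by rewrite mulrCA mulr_gt0// bump2_gt0.
Qed.

Section closed_curve.
Variables (e l : R) (c1 c1' c2 c2' : R -> 'rV[R]_2) (a1 b1 a2 b2 : R).
Hypotheses (e0 : 0 < e) (a10 : 0 < a1) (a20 : 0 < a2) (ab1 : a1 < b1) (ab2 : a2 < b2).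
Hypotheses (C1 : C1_curve c1 c1') (C2 : C1_curve c2 c2').
Hypotheses (c12 : c1 b1 = c2 a2) (c21 : c2 b2 = c1 a1).

Let N z := flux e c1 c1' a1 b1 z + flux e c2 c2' a2 b2 z.
Let dN z w := crossing e c1 c1' a1 b1 z w + crossing e c2 c2' a2 b2 z w.

(** The boundary terms of the two arcs cancel at their common endpoints. *)
Lemma is_derive_closed_flux d d' (t : R) : C1_curve d d' -> 0 < t ->
  is_derive t 1 (fun t => l * N (d t)) (l * dN (d t) (d' t)).
Proof.
move=> dd t0.
have D1 := is_derive_flux e0 a10 ab1 t0 C1 dd.
have D2 := is_derive_flux e0 a20 ab2 t0 C2 dd.
apply: (is_derive_eq (is_deriveZ l (is_deriveD D1 D2))).
rewrite -[_ *: _]/(_ * _); congr (_ * _).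
rewrite c12 c21 /dN; ring.
Qed.

Lemma closed_flux_le d d' (g h : R) : C1_curve d d' -> 0 < g -> g <= h ->
  (forall s t, a1 <= s <= b1 -> g <= t <= h -> `|c1 s - d t| < e -> 0 <= l * det2 (c1' s) (d' t)) ->
  (forall s t, a2 <= s <= b2 -> g <= t <= h -> `|c2 s - d t| < e -> 0 <= l * det2 (c2' s) (d' t)) ->
  l * N (d g) <= l * N (d h).
Proof.
move=> dd g0 gh H1 H2.
rewrite -lerN2.
apply: (@le0_is_derive_le _ (fun t => - (l * N (d t))) (fun t => - (l * dN (d t) (d' t)))) => // t tgh.
  apply: is_deriveN; apply: is_derive_closed_flux => //.
  by case/andP: tgh => /(lt_le_trans g0).
rewrite oppr_le0 mulrDr addr_ge0// crossing_ge0// => s sab; [exact: H1|exact: H2].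
Qed.

(** The transversal intersection at [s0], [t0] makes the derivative positive at [t0], and one such
    time suffices for a strict increase. *)
Lemma closed_flux_lt d d' (g h s0 t0 : R) : C1_curve d d' -> 0 < g -> g < h ->
  (forall s t, a1 <= s <= b1 -> g <= t <= h -> `|c1 s - d t| < e -> 0 <= l * det2 (c1' s) (d' t)) ->
  (forall s t, a2 <= s <= b2 -> g <= t <= h -> `|c2 s - d t| < e -> 0 <= l * det2 (c2' s) (d' t)) ->
  a2 < s0 < b2 -> g < t0 < h -> c2 s0 = d t0 -> 0 < l * det2 (c2' s0) (d' t0) ->
  l * N (d g) < l * N (d h).
Proof.
move=> dd g0 gh H1 H2 s0ab /andP[gt0 t0h] st det0.
apply: (@is_derive_gt0_lt _ (fun t => l * N (d t)) (fun t => l * dN (d t) (d' t)) g h t0).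
- by rewrite ltW.
- move=> t tgh; apply: is_derive_closed_flux => //.
  by case/andP: tgh => /(lt_le_trans g0).
- move=> t tgh; rewrite mulrDr addr_ge0// crossing_ge0// => s sab; [exact: H1|exact: H2].
- have tgh : g <= t0 <= h by rewrite !ltW.
  rewrite mulrDr ltr_wpDl//.
    by apply: crossing_ge0 => // s sab; apply: H1.
  apply: (@crossing_gt0 _ _ _ _ _ _ s0) => //; first by move=> s sab; apply: H2.
  by rewrite st subrr normr0.
Qed.

End closed_curve.

End curves.

(** * Scalar products, determinants and segments in the plane *)

Section planar_algebra.
Context {R : realType}.
Implicit Types (v w z : 'rV[R]_2).

Definition dot2 z w := z 0 0 * w 0 0 + z 0 1 * w 0 1.

Lemma dot2B z z' w : dot2 (z - z') w = dot2 z w - dot2 z' w.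
Proof. by rewrite /dot2 !mxE; ring. Qed.

Lemma dot2D z z' w : dot2 (z + z') w = dot2 z w + dot2 z' w.
Proof. by rewrite /dot2 !mxE; ring. Qed.

Lemma dot2Z a z w : dot2 (a *: z) w = a * dot2 z w.
Proof. by rewrite /dot2 !mxE; ring. Qed.

Lemma ler_norm_dot2 z w : `|dot2 z w| <= 2 * `|z| * `|w|.
Proof.
rewrite -mulrA mulr_natl mulr2n (le_trans (ler_normD _ _))// lerD// normrM ler_pM// ler_norm_coord//.
Qed.

Lemma ler_norm_det2 z w : `|det2 z w| <= 2 * `|z| * `|w|.
Proof.
rewrite -mulrA mulr_natl mulr2n (le_trans (ler_normB _ _))// lerD// normrM ler_pM// ler_norm_coord//.
Qed.

Lemma dot2_gt0 v : v != 0 -> 0 < dot2 v v.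
Proof.
move=> v0; rewrite /dot2 -!expr2 lt0r addr_ge0 ?sqr_ge0// andbT.
apply: contra_neq v0 => /eqP; rewrite paddr_eq0 ?sqr_ge0// !sqrf_eq0 => /andP[/eqP h0 /eqP h1].
by apply: row2P; rewrite mxE.
Qed.

(** The two sides differ by [dot2 w v * det2 v z]. Thus the side towards which a velocity [z]
    crosses the line along [w] is decided by its component along [v]. *)
Lemma det2_orthogonal w v z : dot2 w v = 0 -> det2 w z * dot2 v v = det2 w v * dot2 z v.
Proof.
move=> wv; apply/eqP; rewrite -subr_eq0.
have -> : det2 w z * dot2 v v - det2 w v * dot2 z v = dot2 w v * det2 v z.
  rewrite /det2 /dot2; ring.
by rewrite wv mul0r.
Qed.

(** By Lagrange's identity the squares of [det2 w v] and [dot2 w v] add up to the product of the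
    squared Euclidean norms. *)
Lemma det2_neq0 w v : dot2 w v = 0 -> w != 0 -> v != 0 -> det2 w v != 0.
Proof.
move=> wv /dot2_gt0 w0 /dot2_gt0 v0; apply/eqP => d0.
have : dot2 w w * dot2 v v = det2 w v ^+ 2 + dot2 w v ^+ 2 by rewrite /det2 /dot2; ring.
by rewrite wv d0 expr0n/= addr0 => /eqP; rewrite gt_eqF// mulr_gt0.
Qed.

(** Both vectors lie on the line orthogonal to [v], where the determinant with [v] is a linear
    coordinate. *)
Lemma orthogonal_colinear w v z : dot2 w v = 0 -> dot2 z v = 0 -> det2 w v != 0 ->
  z = (det2 z v / det2 w v) *: w.
Proof.
move=> wv zv d0; apply: row2P; rewrite mxE.
  apply: (mulIf d0); rewrite mulrAC mulfVK//; apply/eqP; rewrite -subr_eq0.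
  have -> : z 0 0 * det2 w v - det2 z v * w 0 0 = z 0 1 * dot2 w v - w 0 1 * dot2 z v.
    rewrite /det2 /dot2; ring.
  by rewrite wv zv !mulr0 subr0.
apply: (mulIf d0); rewrite mulrAC mulfVK//; apply/eqP; rewrite -subr_eq0.
have -> : z 0 1 * det2 w v - det2 z v * w 0 1 = w 0 0 * dot2 z v - z 0 0 * dot2 w v.
  rewrite /det2 /dot2; ring.
by rewrite wv zv !mulr0 subr0.
Qed.

Lemma det2Nl z w : det2 (- z) w = - det2 z w.
Proof. by rewrite /det2 !mxE; ring. Qed.

Lemma det2Dl z z' w : det2 (z + z') w = det2 z w + det2 z' w.
Proof. by rewrite /det2 !mxE; ring. Qed.

Lemma det2Zl a z w : det2 (a *: z) w = a * det2 z w.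
Proof. by rewrite /det2 !mxE; ring. Qed.

Lemma det2Dr z w w' : det2 z (w + w') = det2 z w + det2 z w'.
Proof. by rewrite /det2 !mxE; ring. Qed.

Lemma det2C z w : det2 z w = - det2 w z.
Proof. by rewrite /det2; ring. Qed.

(** The parameter runs from 1 to 2 to comply with the positive times of [C1_curve]. *)
Definition segment (q q' : 'rV[R]_2) (s : R) := q + (s - 1) *: (q' - q).

Lemma segment1 q q' : segment q q' 1 = q.
Proof. by rewrite /segment subrr scale0r addr0. Qed.

Lemma segment2 q q' : segment q q' 2 = q'.
Proof. by rewrite /segment (_ : 2 - 1 = 1) ?scale1r 1?addrC ?subrK//; ring. Qed.

Lemma C1_segment q q' : C1_curve (segment q q') (cst (q' - q)).
Proof.
move=> s _; split; last exact: cvg_cst.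
have -> : segment q q' = cst (q - (q' - q)) + (fun t : R => t *: (q' - q)).
  by apply/funext => t; rewrite /segment scalerBl scale1r !fctE; apply/rowP => i; rewrite !mxE; ring.
have D : is_derive s 1 (fun t : R => t *: (q' - q)) (q' - q).
  have df : differentiable (fun t : R => t *: (q' - q)) s by [].
  split; first by apply/derivable1_diffP.
  by rewrite deriveE// diff_val scale1r.
by apply: (is_derive_eq (is_deriveD (is_derive_cst _ s 1) D)); rewrite add0r.
Qed.

Lemma norm_segment q q' p (r s : R) : `|q - p| < r -> `|q' - p| < r -> 1 <= s <= 2 ->
  `|segment q q' s - p| < r.
Proof.
move=> qr q'r /andP[s1 s2].
have -> : segment q q' s - p = (2 - s) *: (q - p) + (s - 1) *: (q' - p).
  by apply: row2P; rewrite !mxE; ring.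
rewrite (le_lt_trans (ler_normD _ _))// !normrZ ger0_norm ?subr_ge0// ger0_norm ?subr_ge0//.
have -> : r = (2 - s) * r + (s - 1) * r by ring.
(* The two weights cannot both vanish; strictness comes from the first one unless [s = 2]. *)
have [s2'|s2'] := ltP s 2.
  by rewrite ltr_leD// ?ltr_pM2l ?subr_gt0// ler_wpM2l ?subr_ge0// ltW.
by rewrite ler_ltD// ?ler_wpM2l ?subr_ge0 ?(ltW qr)// ltr_pM2l//; lra.
Qed.

End planar_algebra.

(** By compactness the distance attains its minimum. A smoothing radius below it keeps the two arcs
    from interacting. *)
Lemma disjoint_arcs_dist (R : realType) (V : normedModType R) (x : R -> V) (a b a' b' : R) :
  a <= b -> a' <= b' ->
  (forall s, a <= s <= b -> {for s, continuous x}) ->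
  (forall s, a' <= s <= b' -> {for s, continuous x}) ->
  (forall s t, a <= s <= b -> a' <= t <= b' -> x s <> x t) ->
  exists2 e, 0 < e & forall s t, a <= s <= b -> a' <= t <= b' -> e <= `|x s - x t|.
Proof.
move=> ab ab' cx cx' H.
pose A := (`[a, b] `*` `[a', b'] : set (R * R)).
have [|||[s t]] := @compact_EVT_min _ R (fun st : R * R => `|x st.1 - x st.2|) A.
- by exists (a, a'); split; rewrite /= in_itv/= lexx.
- by apply: compact_setX; exact: segment_compact.
- apply: continuous_in_subspaceT => -[s t]; rewrite inE /A/= !in_itv/= => -[sab tab].
  apply: cvg_norm; apply: cvgB.
    by apply: (@continuous_comp _ _ _ fst x); [exact: cvg_fst|exact: cx].
  by apply: (@continuous_comp _ _ _ snd x); [exact: cvg_snd|exact: cx'].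
rewrite inE /A/= !in_itv/= => -[sab tab] Hm.
exists `|x s - x t|; first by rewrite normr_gt0 subr_eq0; apply/eqP; exact: H.
by move=> s' t' s'ab t'ab; apply: (Hm (s', t')); rewrite inE /= !in_itv/=.
Qed.

(** Otherwise [l] times the smoothed winding number would not decrease along the first arc of the
    closed curve [d], would strictly increase along the second, and yet return to its initial
    value. *)
Lemma closed_curves_cross (R : realType) (e l : R)
    (c1 c1' c2 c2' d1 d1' d2 d2' : R -> 'rV[R]_2) (a1 b1 a2 b2 g1 h1 g2 h2 s0 t0 : R) :
  0 < e -> 0 < a1 < b1 -> 0 < a2 < b2 -> 0 < g1 < h1 -> 0 < g2 < h2 ->
  C1_curve c1 c1' -> C1_curve c2 c2' -> C1_curve d1 d1' -> C1_curve d2 d2' ->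
  c1 b1 = c2 a2 -> c2 b2 = c1 a1 -> d1 h1 = d2 g2 -> d2 h2 = d1 g1 ->
  (forall s t, a1 <= s <= b1 -> g1 <= t <= h1 -> `|c1 s - d1 t| < e -> 0 <= l * det2 (c1' s) (d1' t)) ->
  (forall s t, a2 <= s <= b2 -> g1 <= t <= h1 -> `|c2 s - d1 t| < e -> 0 <= l * det2 (c2' s) (d1' t)) ->
  (forall s t, a1 <= s <= b1 -> g2 <= t <= h2 -> `|c1 s - d2 t| < e -> 0 <= l * det2 (c1' s) (d2' t)) ->
  (forall s t, a2 <= s <= b2 -> g2 <= t <= h2 -> `|c2 s - d2 t| < e -> 0 <= l * det2 (c2' s) (d2' t)) ->
  a2 < s0 < b2 -> g2 < t0 < h2 -> c2 s0 = d2 t0 -> ~ (0 < l * det2 (c2' s0) (d2' t0)).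
Proof.
move=> e0 /andP[a10 ab1] /andP[a20 ab2] /andP[g10 gh1] /andP[g20 gh2] C1 C2 D1 D2.
move=> c12 c21 d12 d21 H11 H21 H12 H22 s0ab t0gh st det0.
have L1 := closed_flux_le e0 a10 a20 ab1 ab2 C1 C2 c12 c21 D1 g10 (ltW gh1) H11 H21.
have L2 := closed_flux_lt e0 a10 a20 ab1 ab2 C1 C2 c12 c21 D2 g20 gh2 H12 H22 s0ab t0gh st det0.
by have := le_lt_trans L1; rewrite d12 => /(_ _ L2); rewrite d21 ltxx.
Qed.

(** * Returns of a recurrent orbit to a transversal *)

Section transversal.
Context {R : realType}.
Implicit Types (f : 'rV[R]_2 -> 'rV[R]_2) (x : R -> 'rV[R]_2) (p v z : 'rV[R]_2).

(** In a small ball the field stays close to [f p], so all solutions there cross the lines normal to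
    [f p] in the same direction, at a rate bounded below. *)
Lemma transversal_box f p : locally_lipschitz f -> f p != 0 ->
  exists r L c K : R, [/\ 0 < r, 0 <= L,
    forall z z', `|z - p| < r -> `|z' - p| < r -> `|f z - f z'| <= L * `|z - z'|,
    0 < c /\ 0 < K &
    forall z, `|z - p| < r -> c <= dot2 (f z) (f p) /\ `|f z| <= K].
Proof.
move=> lf v0; have [r [L [r0 L0 Lf]]] := locally_lipschitz_ball p lf.
have Q0 := dot2_gt0 v0; set v := f p in v0 Q0 *; set Q := dot2 v v in Q0 *.
have V0 : 0 < `|v| by rewrite normr_gt0.
(* An error [eps] on the field changes its scalar product with [v] by at most [Q / 2], which leaves
   [c = Q / 2]. *)
pose eps := Num.min 1 (Q / 2 / (2 * `|v|)).
have eps0 : 0 < eps by rewrite lt_min ltr01 !divr_gt0// mulr_gt0.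
have /nbhs_ballP[r' /= r'0 Hr'] : \forall z \near p, `|v - f z| < eps.
  by have /cvgr_dist_lt := @locally_lipschitz_continuous _ _ _ lf p; apply.
exists (Num.min r r'), L, (Q / 2), (`|v| + 1); split => //.
- by rewrite lt_min r0 r'0.
- by move=> z z'; rewrite !lt_min => /andP[zr _] /andP[zr' _]; apply: Lf.
- by rewrite divr_gt0// addr_gt0.
move=> z; rewrite lt_min => /andP[_ zr'].
have := Hr' z; rewrite -ball_normE/= distrC => /(_ zr'); rewrite distrC lt_min => /andP[h1 h2].
split; last first.
  by rewrite -(subrK v (f z)) (le_trans (ler_normD _ _))// addrC lerD2l ltW.
have -> : dot2 (f z) v = Q + dot2 (f z - v) v by rewrite dot2B addrC subrK.
have : `|dot2 (f z - v) v| <= Q / 2.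
  rewrite (le_trans (ler_norm_dot2 _ _))// mulrAC mulrC -ler_pdivlMr ?mulr_gt0//.
  exact: ltW.
rewrite ler_norml => /andP[h3 _]; lra.
Qed.

(** The height [dot2 (x t - p) v] tells on which side of the line through [p] normal to [v] the
    orbit is. *)
Lemma is_derive_height f x p v (t : R) : forward_solution f x -> 0 <= t ->
  is_derive t 1 (fun t => dot2 (x t - p) v) (dot2 (f (x t)) v).
Proof.
move=> fx t0; have D := fx t t0.
have D' : is_derive t 1 (fun t => x t - p) (f (x t)).
  by apply: (is_derive_eq (is_deriveB D (is_derive_cst p t 1))); rewrite subr0.
have D0 := is_derive_coord 0 0 D'; have D1 := is_derive_coord 0 1 D'.
have c0 := is_derive_cst (v 0 0) t 1; have c1 := is_derive_cst (v 0 1) t 1.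
apply: (is_derive_eq (is_deriveD (is_deriveM D0 c0) (is_deriveM D1 c1))).
rewrite -![_ *: _]/(_ * _) /dot2/=; ring.
Qed.

Lemma continuous_height f x p v (t : R) : forward_solution f x -> 0 <= t ->
  {for t, continuous (fun t => dot2 (x t - p) v)}.
Proof. by move=> fx t0; apply: is_derive_continuous (is_derive_height p v fx t0). Qed.

Lemma height_lt f x p v (a b : R) : forward_solution f x -> 0 <= a -> a < b ->
  (forall t, a <= t <= b -> 0 < dot2 (f (x t)) v) ->
  dot2 (x a - p) v < dot2 (x b - p) v.
Proof.
move=> fx a0 ab H.
apply: (@is_derive_gt0_lt _ (fun t => dot2 (x t - p) v) (fun t => dot2 (f (x t)) v) a b a).
- by rewrite lexx.
- by move=> t /andP[at_ _]; apply: (@is_derive_height f) => //; exact: le_trans at_.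
- by move=> t /H/ltW.
- by apply: H; rewrite lexx ltW.
Qed.

Lemma height_IVT f x p v (a b y : R) : forward_solution f x -> 0 <= a -> a < b ->
  dot2 (x a - p) v < y -> y < dot2 (x b - p) v ->
  exists2 t, a < t < b & dot2 (x t - p) v = y.
Proof.
move=> fx a0 ab ay yb.
have [||t] := @IVT _ (fun t => dot2 (x t - p) v) a b y (ltW ab).
- apply: continuous_in_subspaceT => t; rewrite inE/= in_itv/= => /andP[at_ _].
  by apply: (@continuous_height f x p v t fx); exact: le_trans at_.
- have aby := lt_trans ay yb.
  by rewrite (min_idPl (ltW aby)) (max_idPr (ltW aby)) !ltW.
rewrite in_itv/= => /andP[at_ tb] E; exists t => //; apply/andP; split.
  by rewrite lt_neqAle at_ andbT; apply/eqP => at'; move: ay; rewrite at' E ltxx.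
by rewrite lt_neqAle tb andbT; apply/eqP => tb'; move: yb; rewrite -tb' E ltxx.
Qed.

Definition recurrent x := forall s T e : R, 0 <= s -> 0 < e -> exists2 t, T <= t & `|x t - x s| < e.

Lemma near_time x (t e : R) : {for t, continuous x} -> 0 < e ->
  exists2 d, 0 < d & forall s, `|s - t| < d -> `|x s - x t| < e.
Proof.
move=> cx e0.
have /nbhs_ballP[d /= d0 Hd] : \forall s \near t, `|x t - x s| < e by move: cx => /cvgr_dist_lt; apply.
by exists d => // s sd; rewrite distrC; apply: Hd; rewrite /ball/= distrC.
Qed.

(** The height goes from negative to positive between the times [1 - h] and [1 + h]. By recurrence
    the orbit returns near [x (1 - h)], by continuous dependence it then follows its former course
    for a time [2 * h], and so it crosses the normal line again. *)
Lemma transversal_return f x (r T : R) : locally_lipschitz f -> forward_solution f x ->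
  f (x 1) != 0 -> recurrent x -> 0 < r ->
  exists t1, [/\ T < t1, `|x t1 - x 1| < r & dot2 (x t1 - x 1) (f (x 1)) = 0].
Proof.
move=> lf fx v0 rec r0; have [r' [L [c [K [r'0 L0 Lf [c0 K0] Hf]]]]] := transversal_box lf v0.
set p := x 1 in v0 Lf Hf *; set v := f p in v0 Hf *.
have V0 : 0 < `|v| by rewrite normr_gt0.
pose q := Num.min r r'.
have q0 : 0 < q by rewrite lt_min r0 r'0.
have qr : q <= r by rewrite ge_min lexx.
have qr' : q <= r' by rewrite ge_min lexx orbT.
have [d d0 Hd] : exists2 d, 0 < d & forall s, `|s - 1| < d -> `|x s - p| < q / 2.
  apply: near_time; last by rewrite divr_gt0.
  by apply: (forward_solution_continuous fx).
pose h := Num.min (1 / 2) (d / 2).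
have h0 : 0 < h by rewrite lt_min !divr_gt0.
have h1 : h <= 1 / 2 by rewrite ge_min lexx.
have hd : h <= d / 2 by rewrite ge_min lexx orbT.
have near1 t : 1 - h <= t <= 1 + h -> `|x t - p| < q / 2.
  by move=> /andP[? ?]; apply: Hd; rewrite ltr_norml; apply/andP; split; lra.
have near1' t : 1 - h <= t <= 1 + h -> 0 < dot2 (f (x t)) v.
  move=> /near1 tp; have [|+ _] := Hf (x t); last exact: lt_le_trans.
  by rewrite (lt_le_trans tp)//; lra.
have g1 : dot2 (x (1 - h) - p) v < 0.
  have -> : 0 = dot2 (x 1 - p) v by rewrite subrr /dot2 !mxE !mul0r addr0.
  apply: (@height_lt f x p v _ _ fx) => [||t /andP[? ?]]; [lra|lra|].
  by apply: near1'; apply/andP; split; lra.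
have g2 : 0 < dot2 (x (1 + h) - p) v.
  have -> : 0 = dot2 (x 1 - p) v by rewrite subrr /dot2 !mxE !mul0r addr0.
  apply: (@height_lt f x p v _ _ fx) => [||t /andP[? ?]]; [lra|lra|].
  by apply: near1'; apply/andP; split; lra.
have h10 : 0 <= 1 - h by lra.
have fu := forward_solution_shift h10 fx.
(* An error in height below [e1] preserves both signs; [e] is a corresponding error in position. *)
pose e1 := Num.min (- dot2 (x (1 - h) - p) v) (dot2 (x (1 + h) - p) v).
have e10 : 0 < e1 by rewrite lt_min oppr_gt0 g1.
pose e := Num.min (q / 2) (e1 / (2 * `|v|)).
have e0 : 0 < e by rewrite lt_min !divr_gt0// mulr_gt0.
have eq : e <= q / 2 by rewrite ge_min lexx.
have ee : e <= e1 / (2 * `|v|) by rewrite ge_min lexx orbT.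
have [|e' e'0 He'] := @continuous_dependence _ f p r' L (2 * h) _ r'0 L0 Lf fu _ e e0.
  move=> t /andP[t0 t2]; rewrite ltW// (lt_le_trans (near1 _ _))//; last by lra.
  by apply/andP; split; lra.
have [t' Tt' xt'] := rec (1 - h) (Num.max 0 T) e' h10 e'0.
move: Tt'; rewrite ge_max => /andP[t'0 Tt'].
have close t : 0 <= t <= 2 * h -> `|x (t' + t) - x (1 - h + t)| < e.
  by apply: (He' _ (forward_solution_shift t'0 fx)); rewrite !addr0.
have dotclose z z' : `|z - z'| < e -> `|dot2 (z - p) v - dot2 (z' - p) v| < e1.
  move=> zz; rewrite -dot2B opprB addrA subrK (le_lt_trans (ler_norm_dot2 _ _))//.
  by rewrite mulrAC mulrC -ltr_pdivlMr ?mulr_gt0// (lt_le_trans zz).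
have le1 : e1 <= - dot2 (x (1 - h) - p) v by rewrite ge_min lexx.
have le2 : e1 <= dot2 (x (1 + h) - p) v by rewrite ge_min lexx orbT.
have [|||t1 /andP[t1a t1b] gt1] := @height_IVT f x p v t' (t' + 2 * h) 0 fx t'0.
- by lra.
- have := close 0; rewrite lexx !addr0 mulr_ge0 ?(ltW h0)// => /(_ isT)/dotclose.
  by rewrite ltr_norml => /andP[? ?]; lra.
- have := close (2 * h); rewrite lexx mulr_ge0 ?(ltW h0)// => /(_ isT)/dotclose.
  have -> : 1 - h + 2 * h = 1 + h by ring.
  by rewrite ltr_norml => /andP[? ?]; lra.
exists t1; split => //; first exact: le_lt_trans t1a.
have := close (t1 - t'); rewrite [t' + _]addrC subrK => C.
have {}C : `|x t1 - x (1 - h + (t1 - t'))| < e by apply: C; apply/andP; split; lra.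
have N : `|x (1 - h + (t1 - t')) - p| < q / 2 by apply: near1; apply/andP; split; lra.
have -> : x t1 - p = (x t1 - x (1 - h + (t1 - t'))) + (x (1 - h + (t1 - t')) - p).
  by rewrite addrA subrK.
by rewrite (le_lt_trans (ler_normD _ _))//; lra.
Qed.

End transversal.

Lemma C1_forward_solution (R : realType) (f : 'rV[R]_2 -> 'rV[R]_2) x :
  locally_lipschitz f -> forward_solution f x -> C1_curve x (f \o x).
Proof.
move=> lf fx s s0; split; first exact: fx (ltW s0).
apply: continuous_comp; last exact: locally_lipschitz_continuous.
by apply: (forward_solution_continuous fx); exact: ltW.
Qed.

(** The field points to the positive side near [p], so the height is positive just after [t1]. The
    height reached serves as the margin [G] of [transversal_approach]. *)
Lemma transversal_departure (R : realType) (f : 'rV[R]_2 -> 'rV[R]_2) x p v (r th t1 : R) :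
  forward_solution f x -> 0 < t1 -> 0 < th -> th <= r / 4 ->
  (forall z, `|z - p| < r -> 0 < dot2 (f z) v) ->
  `|x t1 - p| < r / 2 -> dot2 (x t1 - p) v = 0 ->
  exists m, [/\ 0 < m, forall t, t1 <= t <= t1 + m -> `|x t - x t1| < th &
    0 < dot2 (x (t1 + m) - p) v].
Proof.
move=> fx t10 th0 th1 Hf xt1 gt1.
have [m m0 Hm] : exists2 d, 0 < d & forall s, `|s - t1| < d -> `|x s - x t1| < th.
  by apply: near_time => //; apply: (forward_solution_continuous fx); exact: ltW.
have after t : t1 <= t <= t1 + m / 2 -> `|x t - x t1| < th.
  by move=> /andP[? ?]; apply: Hm; rewrite ltr_norml; apply/andP; split; lra.
exists (m / 2); split => //; first by rewrite divr_gt0.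
rewrite -gt1; apply: (@height_lt _ f x p v _ _ fx) => [||t /after tm]; [exact: ltW|lra|].
apply: Hf; have -> : x t - p = (x t - x t1) + (x t1 - p) by rewrite addrA subrK.
by rewrite (le_lt_trans (ler_normD _ _))//; lra.
Qed.

(** A return near [x 1] could fall on either side of the normal line. The return is made instead
    near a point [x tau] just before [x 1], whose height [g] lies strictly between [- G] and 0. *)
Lemma transversal_approach (R : realType) (f : 'rV[R]_2 -> 'rV[R]_2) x v (r th G T : R) :
  forward_solution f x -> recurrent x -> 0 < th -> th <= r -> 0 < G -> v != 0 ->
  (forall z, `|z - x 1| < r -> 0 < dot2 (f z) v) ->
  exists t2, [/\ T <= t2, `|x t2 - x 1| < th, dot2 (x t2 - x 1) v < 0 & - G < dot2 (x t2 - x 1) v].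
Proof.
move=> fx rec th0 thr G0 v0 Hf.
have V0 : 0 < 2 * `|v| by rewrite mulr_gt0// normr_gt0.
pose eps := Num.min (th / 2) (G / (2 * `|v|)).
have eps0 : 0 < eps by rewrite lt_min !divr_gt0.
have eps1 : eps <= th / 2 by rewrite ge_min lexx.
have eps2 : 2 * `|v| * eps <= G by rewrite mulrC -ler_pdivlMr// ge_min lexx orbT.
have [n n0 Hn] : exists2 d, 0 < d & forall s, `|s - 1| < d -> `|x s - x 1| < eps.
  by apply: near_time => //; exact: (forward_solution_continuous fx).
pose k := Num.min (1 / 2) (n / 2).
have k0 : 0 < k by rewrite lt_min !divr_gt0.
have k1 : k <= 1 / 2 by rewrite ge_min lexx.
have kn : k <= n / 2 by rewrite ge_min lexx orbT.
pose tau := 1 - k.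
have tau0 : 0 <= tau by rewrite /tau; lra.
have tau1 : tau < 1 by rewrite /tau; lra.
have before t : tau <= t <= 1 -> `|x t - x 1| < eps.
  by rewrite /tau => /andP[? ?]; apply: Hn; rewrite ltr_norml; apply/andP; split; lra.
have taup : `|x tau - x 1| < eps by apply: before; rewrite lexx ltW.
have g0 : dot2 (x tau - x 1) v < 0.
  have -> : 0 = dot2 (x 1 - x 1) v by rewrite subrr /dot2 !mxE !mul0r addr0.
  apply: (@height_lt _ f x (x 1) v _ _ fx) => // t /before tt.
  by apply: Hf; lra.
have gG : - G < dot2 (x tau - x 1) v.
  have : `|dot2 (x tau - x 1) v| < G.
    rewrite (le_lt_trans (ler_norm_dot2 _ _))// (lt_le_trans _ eps2)//.
    by rewrite mulrAC ltr_pM2l.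
  by rewrite ltr_norml => /andP[].
move gE : (dot2 (x tau - x 1) v) g0 gG => g g0 gG.
(* An error in height below [Num.min (- g) (G + g)] keeps the height strictly between [- G] and
   0. *)
pose e := Num.min (th / 2) (Num.min (- g) (G + g) / (2 * `|v|)).
have e0 : 0 < e.
  by rewrite lt_min divr_gt0//= divr_gt0// lt_min oppr_gt0 g0/=; lra.
have e1 : e <= th / 2 by rewrite ge_min lexx.
have [t2 Tt2 xt2] := rec tau T e tau0 e0.
have dg : `|dot2 (x t2 - x 1) v - g| < Num.min (- g) (G + g).
  rewrite -gE -dot2B opprB addrA subrK (le_lt_trans (ler_norm_dot2 _ _))//.
  rewrite mulrAC mulrC -ltr_pdivlMr// (lt_le_trans xt2)//.
  by rewrite gE ge_min lexx orbT.
move: dg; rewrite lt_min !ltr_norml => /andP[/andP[_ dg1] /andP[dg2 _]].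
exists t2; split => //; [|lra|lra].
have -> : x t2 - x 1 = (x t2 - x tau) + (x tau - x 1) by rewrite addrA subrK.
by rewrite (le_lt_trans (ler_normD _ _))//; lra.
Qed.

(** The endpoints have opposite heights, so the midpoint, at parameter [3 / 2], lies on the normal
    line through [p]. It is close to the midpoint of [p] and [z1], which puts it strictly between
    them. *)
Lemma chords_cross (R : realType) (p v z1 z2 z3 : 'rV[R]_2) (th : R) (W := z1 - p) :
  dot2 W v = 0 -> dot2 (z3 - p) v = - dot2 (z2 - p) v -> 0 < `|det2 W v| ->
  `|z2 - p| < th -> `|z3 - z1| < th -> 4 * `|v| * th <= `|det2 W v| -> 0 < `|v| ->
  exists2 mu, 0 < mu < 1 & segment z2 z3 (3 / 2) = p + mu *: W.
Proof.
move=> Wv g3 D0 zp z31 hth v0; rewrite normr_gt0 in D0.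
pose z := segment z2 z3 (3 / 2) - p.
have zE : z = 2^-1 *: ((z2 - p) + (z3 - p)).
  by apply: row2P; rewrite !mxE; field.
have zv : dot2 z v = 0 by rewrite zE dot2Z dot2D g3 subrr mulr0.
exists (det2 z v / det2 W v); last first.
  by rewrite -(orthogonal_colinear Wv zv D0) /z addrC subrK.
(* [E] is the total displacement of the endpoints from [p] and [z1]; it moves [mu] away from [1 / 2]
   by less than [1 / 2]. *)
pose E := (z2 - p) + (z3 - z1).
have zE' : z = 2^-1 *: (W + E).
  by rewrite zE; congr (_ *: _); rewrite /E /W; apply/rowP => i; rewrite !mxE; ring.
have nE : `|det2 E v / det2 W v| < 1.
  have nE : `|E| < 2 * th by rewrite (le_lt_trans (ler_normD _ _))//; lra.
  rewrite normrM normfV ltr_pdivrMr ?normr_gt0// mul1r (le_lt_trans (ler_norm_det2 _ _))//.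
  rewrite (lt_le_trans _ hth)// mulrAC.
  have -> : 4 * `|v| * th = 2 * `|v| * (2 * th) by ring.
  by rewrite ltr_pM2l// mulr_gt0.
have -> : det2 z v / det2 W v = 2^-1 + 2^-1 * (det2 E v / det2 W v).
  by rewrite zE' det2Zl det2Dl mulrDr mulrDl -!mulrA divff// mulr1.
by move: nE; rewrite ltr_norml => /andP[? ?]; apply/andP; split; lra.
Qed.

(** For [E = 0] the product is [det2 w v ^+ 2 * dot2 z v / dot2 v v], and the bound on [th] keeps
    the contribution of [E] from outweighing it. This handles the second chord, which is only nearly
    parallel to the normal line. *)
Lemma det2_perturb_ge0 (R : realType) (v w E z : 'rV[R]_2) (c K th : R) :
  dot2 w v = 0 -> v != 0 -> c <= dot2 z v -> `|z| <= K -> `|E| <= 2 * th -> 0 <= K ->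
  4 * K * th <= `|det2 w v| * c / dot2 v v ->
  0 <= - det2 w v * det2 z (w + E).
Proof.
move=> wv /dot2_gt0 Q0 cz zK Eth K0 hth.
set D := det2 w v in hth *.
have DwE : D * det2 w z = D ^+ 2 * dot2 z v / dot2 v v.
  have := det2_orthogonal z wv; rewrite -/D => h; apply: (mulIf (lt0r_neq0 Q0)).
  by rewrite divfK ?gt_eqF// expr2 -!mulrA h.
rewrite det2Dr mulrDr mulNr det2C mulrN opprK DwE.
have h1 : D ^+ 2 * c / dot2 v v <= D ^+ 2 * dot2 z v / dot2 v v.
  by rewrite ler_wpM2r ?invr_ge0 ?(ltW Q0)// ler_wpM2l// sqr_ge0.
have h2 : `|- D * det2 z E| <= D ^+ 2 * c / dot2 v v.
  rewrite normrM normrN.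
  have -> : D ^+ 2 * c / dot2 v v = `|D| * (`|D| * c / dot2 v v).
    by rewrite -real_normK ?num_real// expr2 !mulrA.
  rewrite ler_wpM2l// (le_trans _ hth)// (le_trans (ler_norm_det2 _ _))//.
  have -> : 4 * K * th = 2 * K * (2 * th) by ring.
  by rewrite ler_pM ?mulr_ge0// ler_wpM2l.
by move: h2; rewrite ler_norml => /andP[h2 _]; rewrite -lerBlDr sub0r (le_trans _ h1)// lerNl.
Qed.

(** * Contradiction from an injective recurrent orbit, and the theorem *)

Lemma recurrent_not_injective (R : realType) (f : 'rV[R]_2 -> 'rV[R]_2) (x : R -> 'rV[R]_2) :
  locally_lipschitz f -> forward_solution f x -> recurrent x -> f (x 1) != 0 ->
  exists s t, [/\ 0 <= s, s < t & x s = x t].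
Proof.
move=> lf fx rec v0; apply: contrapT => /forallNP inj.
have xinj s t : 0 <= s -> s < t -> x s <> x t.
  by move=> s0 st xst; apply: (inj s); exists t.
have [r [L [c [K [r0 L0 _ [c0 K0] Hf]]]]] := transversal_box lf v0.
have r20 : 0 < r / 2 by rewrite divr_gt0.
have [t1 [t11 xt1 Wv]] := transversal_return 1 lf fx v0 rec r20.
set p := x 1 in v0 Hf xt1 Wv *; set v := f p in v0 Hf Wv *.
set W := x t1 - p in xt1 Wv *.
have C1x := C1_forward_solution lf fx.
have cx t : 0 <= t -> {for t, continuous x}.
  by move=> t0; exact: (forward_solution_continuous fx t0).
have W0 : W != 0.
  by apply/eqP => /subr0_eq E; apply: (xinj 1 t1 ler01 t11); rewrite E.
have V0 : 0 < `|v| by rewrite normr_gt0.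
have Q0 := dot2_gt0 v0.
have D0 := det2_neq0 Wv W0 v0; set D := det2 W v in D0.
have nD0 : 0 < `|D| by rewrite normr_gt0.
have D20 : 0 < D ^+ 2 by rewrite exprn_even_gt0.
(* The three bounds keep the points in the ball, give the sign in [det2_perturb_ge0], and make the
   chords cross. *)
pose th := Num.min (r / 4) (Num.min (`|D| * c / dot2 v v / (4 * K)) (`|D| / (4 * `|v|))).
have th0 : 0 < th by rewrite !lt_min !divr_gt0// ?mulr_gt0.
have th1 : th <= r / 4 by rewrite ge_min lexx.
have th2 : 4 * K * th <= `|D| * c / dot2 v v.
  by rewrite mulrC -ler_pdivlMr ?mulr_gt0// !ge_min lexx orbT.
have th3 : 4 * `|v| * th <= `|D|.
  by rewrite mulrC -ler_pdivlMr ?mulr_gt0// !ge_min lexx !orbT.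
have Hf0 z : `|z - p| < r -> 0 < dot2 (f z) v by move=> /Hf[+ _]; exact: lt_le_trans.
have t10 := lt_trans ltr01 t11.
have [m [m0 after top]] := transversal_departure fx t10 th0 th1 Hf0 xt1 Wv.
have thr : th <= r by clear -th1 r0; lra.
(* [t2] comes after [t1 + m], hence after the future [t3], and its depth below the normal line is
   less than the height reached at [t1 + m]. *)
have [t2 [t2m xt2 g20 g2G]] := transversal_approach (t1 + m + 1) fx rec th0 thr top v0 Hf0.
(* At [t3] the height is opposite to the one at [t2], so that the midpoint of the second chord lies
   on the normal line. *)
have [||||t3 /andP[t31 t3m] g3] := @height_IVT _ f x p v t1 (t1 + m) (- dot2 (x t2 - p) v) fx.
- exact: ltW.
- by rewrite ltrDl.
- by rewrite -/W Wv oppr_gt0.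
- by rewrite ltrNl.
have xt3 : `|x t3 - x t1| < th by apply: after; rewrite !ltW.
have t32 : t3 < t2 by rewrite (lt_le_trans t3m)// (le_trans _ t2m)// lerDl.
have [mu mu01 Hmu] := chords_cross Wv g3 nD0 xt2 xt3 th3 V0.
clear after top g2G t2m t3m m m0 rec inj.
pose w := x t3 - x t2.
have dw : 0 < dot2 w v.
  have -> : w = (x t3 - p) - (x t2 - p) by rewrite opprB addrA subrK.
  by rewrite dot2B g3 subr_gt0 (lt_trans g20)// oppr_gt0.
(* The two time intervals are disjoint since [t1 < t3], so injectivity separates the arcs. *)
have [e1 e10 He1] : exists2 e, 0 < e &
    forall s t, 1 <= s <= t1 -> t3 <= t <= t2 -> e <= `|x s - x t|.
  have t30 := lt_trans t10 t31.
  apply: disjoint_arcs_dist => [||s /andP[s1 _]|s /andP[s1 _]|s t /andP[s1 st] /andP[tt _]].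
  - exact: ltW.
  - exact: ltW.
  - by apply: cx; exact: le_trans s1.
  - by apply: cx; apply: le_trans s1; exact: ltW.
  - by apply: xinj; [exact: le_trans s1|rewrite (le_lt_trans st)// (lt_le_trans t31)].
(* Below [e1] the arcs of orbit do not interact. Below [r / 4], points near a chord stay in the ball
   of radius [r], the chords being within [3 / 4 * r] of [p]. *)
pose e := Num.min e1 (r / 4).
have e0 : 0 < e by rewrite lt_min e10 divr_gt0.
have er : e <= r / 4 by rewrite ge_min lexx orbT.
have rsplit : r = r / 4 + 3 / 4 * r by field.
have ball_near z z' : `|z - z'| < e -> `|z' - p| < 3 / 4 * r -> `|z - p| < r.
  move=> zz z'p; have -> : z - p = (z - z') + (z' - p) by rewrite addrA subrK.
  by rewrite (le_lt_trans (ler_normD _ _))// rsplit ltrD// (lt_le_trans zz).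
have [q1 q2 q3] : [/\ 0 < 3 / 4 * r, r / 2 <= 3 / 4 * r & r / 4 + r / 2 = 3 / 4 * r].
  by clear -r0; split; lra.
have segC s : 1 <= s <= 2 -> `|segment (x t1) p s - p| < 3 / 4 * r.
  apply: norm_segment; last by rewrite subrr normr0.
  exact: lt_le_trans q2.
have segD s : 1 <= s <= 2 -> `|segment (x t2) (x t3) s - p| < 3 / 4 * r.
  apply: norm_segment.
    by rewrite (lt_le_trans xt2)// (le_trans th1)// -q3 lerDl ltW.
  have -> : x t3 - p = (x t3 - x t1) + W by rewrite /W addrA subrK.
  by rewrite (le_lt_trans (ler_normD _ _))// -q3 ltrD// (lt_le_trans xt3).
pose E := (x t3 - x t1) - (x t2 - p).
have wE : w = W + E by rewrite /w /E /W [x t1 - p]addrC; apply/rowP => i; rewrite !mxE; ring.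
have nE : `|E| <= 2 * th.
  by rewrite (le_trans (ler_normB _ _))// mulr_natl mulr2n lerD// ltW.
(* With [l = - D], the first chord meets any velocity [z] with the sign of [dot2 z v]. *)
have cross z : - D * det2 (p - x t1) z = D ^+ 2 * dot2 z v / dot2 v v.
  have -> : p - x t1 = - W by rewrite opprB.
  have := det2_orthogonal z Wv; rewrite -/D => h.
  apply: (mulIf (lt0r_neq0 Q0)).
  by rewrite divfK ?gt_eqF// det2Nl mulrNN expr2 -!mulrA h.
(* The first chord runs from [x t1] back to [p], so [p + mu *: W] has parameter [2 - mu] on it. *)
have [m1 m2] : 1 < 2 - mu /\ 2 - mu < 2 by case/andP: mu01 => h1 h2; clear -h1 h2; split; lra.
have [l1 l2] : 1 < 3 / 2 :> R /\ 3 / 2 < 2 :> R by clear; split; lra.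
(* Of the four sign conditions, the one for the two arcs is vacuous, since they are never within
   [e]; [cross] settles the first chord against the second arc and the second chord, and
   [det2_perturb_ge0] the first arc against the second chord. *)
apply: (@closed_curves_cross _ e (- D) x (f \o x) (segment (x t1) p) (cst (p - x t1))
   x (f \o x) (segment (x t2) (x t3)) (cst w) 1 t1 1 2 t3 t2 1 2 (2 - mu) (3 / 2)) => //.
- by rewrite ltr01.
- by rewrite ltr01 ltr1n.
- by rewrite t32 (lt_trans t10).
- by rewrite ltr01 ltr1n.
- exact: C1_segment.
- exact: C1_segment.
- by rewrite segment1.
- by rewrite segment2.
- by rewrite segment1.
- by rewrite segment2.
- by move=> s t st tt; rewrite lt_min ltNge He1.
- move=> s t st tt near_st; rewrite /= cross.
  rewrite divr_ge0 ?(ltW Q0)// mulr_ge0 ?(ltW D20)// ltW// Hf0//.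
  by apply: (@ball_near _ (segment (x t1) p s)); [rewrite distrC|exact: segC].
- move=> s t st tt near_st /=.
  have /Hf[c1 K1] : `|x s - p| < r by apply: ball_near near_st _; exact: segD.
  rewrite wE; exact: (det2_perturb_ge0 Wv v0 c1 K1 nE (ltW K0) th2).
- move=> s t st tt near_st; rewrite /= cross.
  by rewrite divr_ge0 ?(ltW Q0)// mulr_ge0 ?(ltW D20) ?(ltW dw).
- by rewrite m1.
- by rewrite l1.
- rewrite Hmu /segment; apply: row2P; rewrite !mxE; clear; ring.
- by rewrite /= cross divr_gt0// mulr_gt0.
Qed.

Theorem theorem1 (R : realType) (f : 'rV[R]_2 -> 'rV[R]_2) (Omega : set 'rV[R]_2)
    (hf : locally_lipschitz f) (hOmega : minimal_set f Omega) :
  (exists2 y : 'rV[R]_2, f y = 0 & Omega = [set y]) \/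
  (exists2 x : R -> 'rV[R]_2, periodic_solution f x & Omega = range x).
Proof.
have [[[y Oy] cO iO] _] := hOmega.
have [x0 [/solution_on_forward[x fx xx0] x0y x0O]] := iO y Oy.
have xO t : 0 <= t -> Omega (x t) by move=> t0; rewrite xx0//; exact: x0O.
(* The base time is 1 rather than 0 because the argument uses the orbit just before the base
   point. *)
have [f0|v0] := eqVneq (f (x 1)) 0.
  left; exists (x 1) => //.
  by apply: (minimal_set_stationary hOmega) => //; exact: xO.
right; have rec : recurrent x by exact: (minimal_set_recurrent hf hOmega fx xO).
have [s [t [s0 st xst]]] := recurrent_not_injective hf fx rec v0.
exact: (minimal_set_periodic hf hOmega fx xO s0 st xst).
Qed.
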